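(* Let $\mathcal{H}$ be a complex Hilbert space, $E,F$ real orthogonal projections on $\mathcal{H}$, and $V(t)=e^{itQ}$ a unitary one-parameter group whose selfadjoint generator satisfies $Q\ge m\cdot1$ for some $m>0$. If there exists $\delta>0$ such that $E\le V(t)F'V(t)^*$ for all $t\in[-\delta,\delta]$, then (a) $\|EF\|\le e^{-m\delta}$; (b) $E\wedge F=0$; (c) $\|E+F-E\vee F\|\le e^{-m\delta}$.
   Context: Real orthogonal projections are real linear idempotents selfadjoint with respect to $\mathrm{Re}\langle\cdot,\cdot\rangle$, i.e. projections onto closed real subspaces. $E\le F$ means $E\mathcal{H}\subset F\mathcal{H}$. $F'=1+iFi$ is the projection onto the symplectic complement $\{\xi:\mathrm{Im}\langle\xi,h\rangle=0\ \forall h\in F\mathcal{H}\}$. $E\wedge F$ is the projection onto $E\mathcal{H}\cap F\mathcal{H}$ and $E\vee F$ the projection onto the closed real span of $E\mathcal{H}\cup F\mathcal{H}$. *)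

(* Defs.v *)
From HB Require Import structures.
From mathcomp Require Import all_boot all_order all_algebra.
From mathcomp Require Import complex.
From mathcomp Require Import all_classical all_reals.
From mathcomp Require Import sequences exp.
Set Implicit Arguments. Unset Strict Implicit. Unset Printing Implicit Defensive.
Import Order.TTheory GRing.Theory Num.Theory.
Local Open Scope ring_scope.
Local Open Scope complex_scope.

Section Hilbert.
Variables (R : realType) (H : lmodType R[i]) (ip : H -> H -> R[i]).

Definition hnorm (x : H) : R := Num.sqrt (complex.Re (ip x x)).

Definition is_hilbert : Prop :=
  [/\ (forall (a : R[i]) (x y z : H), ip (a *: x + y) z = a * ip x z + ip y z),
      (forall x y : H, ip y x = conjc (ip x y)),
      (forall x : H, complex.Im (ip x x) = 0 /\ 0 <= complex.Re (ip x x)),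
      (forall x : H, ip x x = 0 -> x = 0) &
      (forall u : nat -> H,
         (forall e : R, 0 < e -> exists N : nat, forall p q : nat,
             (N <= p)%N -> (N <= q)%N -> hnorm (u p - u q) < e) ->
         exists l : H, forall e : R, 0 < e -> exists N : nat, forall p : nat,
             (N <= p)%N -> hnorm (u p - l) < e)].

Definition real_orth_proj (P : H -> H) : Prop :=
  [/\ (forall x y : H, P (x + y) = P x + P y),
      (forall (r : R) (x : H), P (r%:C *: x) = r%:C *: P x),
      (forall x : H, P (P x) = P x) &
      (forall x y : H, complex.Re (ip (P x) y) = complex.Re (ip x (P y)))].

Definition range_of (P : H -> H) (x : H) : Prop := exists y : H, P y = x.

Definition proj_le (P Q : H -> H) : Prop :=
  forall x : H, range_of P x -> range_of Q x.

Definition symp_compl (F : H -> H) : H -> H := fun x => x + 'i *: F ('i *: x).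

Definition op_norm_le (T : H -> H) (c : R) : Prop :=
  forall x : H, hnorm (T x) <= c * hnorm x.

Definition is_meet (E F K : H -> H) : Prop :=
  real_orth_proj K /\
  forall x : H, range_of K x <-> (range_of E x /\ range_of F x).

Definition is_join (E F J : H -> H) : Prop :=
  real_orth_proj J /\
  forall x : H, range_of J x <->
    (forall e : R, 0 < e -> exists a b : H, hnorm (x - (E a + F b)) < e).

Definition unitary_group (V : R -> H -> H) : Prop :=
  [/\ (forall (t : R) (a : R[i]) (x y : H), V t (a *: x + y) = a *: V t x + V t y),
      (forall (t : R) (x y : H), ip (V t x) (V t y) = ip x y),
      (forall x : H, V 0 x = x),
      (forall (s t : R) (x : H), V (s + t) x = V s (V t x)) &
      (forall (x : H) (t0 e : R), 0 < e -> exists2 d : R, 0 < d &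
         forall t : R, `|t - t0| < d -> hnorm (V t x - V t0 x) < e)].

(* x is in the domain of the derivative of V at 0 with derivative y:
   y = lim_{t -> 0} (V t x - x) / t ; then, for V(t) = e^{itQ}, Q x = -i y *)
Definition deriv0 (V : R -> H -> H) (x y : H) : Prop :=
  forall e : R, 0 < e -> exists2 d : R, 0 < d &
    forall t : R, t != 0 -> `|t| < d -> hnorm ((t^-1)%:C *: (V t x - x) - y) < e.

(* the selfadjoint generator Q of V (V t = e^{itQ}) satisfies Q >= m 1:
   <Q x, x> >= m ||x||^2 for every x in the domain of Q *)
Definition generator_ge (V : R -> H -> H) (m : R) : Prop :=
  forall x y : H, deriv0 V x y ->
    m * hnorm x ^+ 2 <= complex.Re (ip (- 'i *: y) x).

End Hilbert.

(* Main.v *)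
Require Import Defs.
From HB Require Import structures.
From mathcomp Require Import all_boot all_order all_algebra.
From mathcomp Require Import complex.
From mathcomp Require Import ring lra.
From mathcomp Require Import all_classical all_reals.
From mathcomp Require Import sequences exp.
From mathcomp Require Import all_analysis.
From mathcomp Require Import measurable_realfun.
Import Order.TTheory GRing.Theory Num.Theory.
Import numFieldNormedType.Exports.
Local Open Scope classical_set_scope.
Local Open Scope ring_scope.
Local Open Scope complex_scope.

(** For a in the range of E and b in the range of F, the hypothesis says that
    f(x) = <V(x) a, b> is real on [-delta, delta].  As Q >= m, f extends to the
    upper half-plane with |f(x + iy)| <= e^{-my} |a| |b|, so f e^{ms},
    with s(z) = sqrt (delta^2 - z^2), is bounded there, and its value
    at 0 is controlled by the two sides of the cut |x| >= delta through the
    harmonic measure delta dx / (pi |x| sqrt (x^2 - delta^2)).  Concretely, we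
    test f against the kernel
      K(z) = e^{m's(z)} / ((s(z) + kappa) (z + i eta)),   0 <= m' < m.
    The vectors w(y) = \int K(x + iy) V(x) a dx satisfy w' = Q w, so |w(y)|
    grows at least like e^{my}; but |K| allows only e^{m'y}, whence w = 0.
    Letting y -> 0 gives \int K f = 0.  Its imaginary part on [-delta, delta]
    is a Poisson kernel at 0 as eta -> 0, and the rest is a tail of modulus
    1 / (|x| sqrt (x^2 - delta^2 + kappa^2)), so that after kappa -> 0 and
    m' -> m one gets |f(0)| <= e^{-m delta} |a| |b|. *)

Set Implicit Arguments.
Unset Strict Implicit.
Unset Printing Implicit Defensive.

(** * Complex modulus and the real inner product *)

(** The bound [Q >= m] is available only at vectors whose orbit is differentiable, and no spectral
    resolution of [Q] is used. Averaging an orbit against a smooth kernel produces such vectors. The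
    group translates the kernel along the real axis, so [Q] acts on the averages as a horizontal
    derivative, which analyticity of the kernel turns into a vertical one. The extension of f to the
    half-plane is thus never constructed: all analyticity sits in the kernel. The parameters remove
    three obstacles: [eta] moves the pole of 1/z below the half-plane, [kappa] keeps the other
    denominator from vanishing at the branch points, and [m' < m] leaves the exponential room that
    forces the averages to vanish. On [-delta, delta] the root s is real, so Kf owes its imaginary
    part to the pole alone; on the cut s is imaginary, so the exponential has modulus one there. The
    gain e^{m' delta} at 0 is therefore paid for nowhere. All three conclusions follow from one
    bound on Re <Ex, Fy>, the cosine of the angle between the two ranges. *)

Section ComplexModulus.
Variable R : realType.
Implicit Types z w : R[i].

Lemma ReM z w : complex.Re (z * w) = complex.Re z * complex.Re w - complex.Im z * complex.Im w.
Proof. by case: z w => [a b] [c d]. Qed.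

Lemma ImM z w : complex.Im (z * w) = complex.Re z * complex.Im w + complex.Im z * complex.Re w.
Proof. by case: z w => [a b] [c d]. Qed.

Lemma ReD z w : complex.Re (z + w) = complex.Re z + complex.Re w.
Proof. by case: z w => [a b] [c d]. Qed.

Lemma ImD z w : complex.Im (z + w) = complex.Im z + complex.Im w.
Proof. by case: z w => [a b] [c d]. Qed.

Lemma ReN z : complex.Re (- z) = - complex.Re z.
Proof. by case: z. Qed.

Lemma ImN z : complex.Im (- z) = - complex.Im z.
Proof. by case: z. Qed.

Lemma Re_real (r : R) : complex.Re (r%:C) = r. Proof. by []. Qed.
Lemma Im_real (r : R) : complex.Im (r%:C) = 0. Proof. by []. Qed.

Definition cabs z : R := Num.sqrt (complex.Re z ^+ 2 + complex.Im z ^+ 2).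
Local Notation nc := cabs.

Lemma cabsE z : cabs z = Normc.normc z. Proof. by case: z. Qed.

Lemma cabsM z w : nc (z * w) = nc z * nc w.
Proof. by rewrite !cabsE Normc.normcM. Qed.

Lemma cabsV z : nc z^-1 = (nc z)^-1.
Proof. by rewrite !cabsE Normc.normcV. Qed.

Lemma cabsN z : nc (- z) = nc z.
Proof. by rewrite !cabsE normcN. Qed.

Lemma cabsD z w : nc (z + w) <= nc z + nc w.
Proof. rewrite !cabsE; exact: le_normcD. Qed.

Lemma cabs_eq0 z : nc z = 0 -> z = 0.
Proof. by rewrite cabsE => /Normc.eq0_normc. Qed.

Lemma cabs_ge0 z : 0 <= nc z.
Proof. exact: sqrtr_ge0. Qed.

Lemma cabs_sqr z : nc z ^+ 2 = complex.Re z ^+ 2 + complex.Im z ^+ 2.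
Proof. by rewrite sqr_sqrtr // addr_ge0 ?sqr_ge0. Qed.

Lemma cabs_real (r : R) : nc r%:C = `|r|.
Proof. by rewrite /cabs /= expr0n /= addr0 sqrtr_sqr. Qed.

Lemma ler_Re_cabs z : `|complex.Re z| <= nc z.
Proof.
rewrite -[leRHS]ger0_norm ?cabs_ge0 // -ler_sqr ?nnegrE // !real_normK ?num_real //.
by rewrite cabs_sqr lerDl sqr_ge0.
Qed.

Lemma ler_Im_cabs z : `|complex.Im z| <= nc z.
Proof.
rewrite -[leRHS]ger0_norm ?cabs_ge0 // -ler_sqr ?nnegrE // !real_normK ?num_real //.
by rewrite cabs_sqr lerDr sqr_ge0.
Qed.

Lemma cabs_le z (c : R) : 0 <= c -> complex.Re z ^+ 2 + complex.Im z ^+ 2 <= c ^+ 2 -> nc z <= c.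
Proof. by move=> c0; rewrite -cabs_sqr ler_sqr ?nnegrE ?cabs_ge0. Qed.

Lemma cabs_gt0 z : (0 < nc z) = (z != 0).
Proof.
rewrite lt_neqAle cabs_ge0 andbT eq_sym; congr negb.
by apply/eqP/eqP => [/cabs_eq0 //|->]; rewrite cabs_real normr0.
Qed.

Lemma cabsX z n : nc (z ^+ n) = nc z ^+ n.
Proof.
elim: n => [|n ih]; first by rewrite !expr0 cabs_real normr1.
by rewrite !exprS cabsM ih.
Qed.

Lemma cabsB z w : nc (z - w) <= nc z + nc w.
Proof. by rewrite -(cabsN w) cabsD. Qed.

Lemma le_Re_cabs z : complex.Re z <= nc z.
Proof. exact: le_trans (ler_norm _) (ler_Re_cabs z). Qed.

End ComplexModulus.

Lemma scale_ReIm (R : realType) (H : lmodType R[i]) (c : R[i]) (x : H) :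
  c *: x = (complex.Re c)%:C *: x + (complex.Im c)%:C *: ('i *: x).
Proof.
by rewrite scalerA -scalerDl; congr (_ *: _); rewrite {1}[c]complexE ['i * _]mulrC.
Qed.

Section HilbertSpace.
Variables (R : realType) (H : lmodType R[i]) (ip : H -> H -> R[i]).
Hypothesis hH : is_hilbert ip.
Local Notation nc := (@cabs R).
Local Notation hnorm := (hnorm ip).

(** The projections are only real linear, so adjoints, angles and Riesz representation all refer to
    the underlying real Hilbert space. *)
Definition rip (x y : H) : R := complex.Re (ip x y).
Local Notation B := rip.

Lemma ipDl x y z : ip (x + y) z = ip x z + ip y z.
Proof. by case: hH => L _ _ _ _; rewrite -[x in LHS]scale1r L mul1r. Qed.

Lemma ip0l z : ip 0 z = 0.
Proof. by apply: (addrI (ip 0 z)); rewrite -ipDl !addr0. Qed.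

Lemma ipZl a x z : ip (a *: x) z = a * ip x z.
Proof. by case: hH => L _ _ _ _; rewrite -[a *: x]addr0 L ip0l addr0. Qed.

Lemma ripC x y : B x y = B y x.
Proof. by case: hH => _ S _ _ _; rewrite /rip S; case: (ip y x). Qed.

Lemma ripDl x y z : B (x + y) z = B x z + B y z.
Proof. by rewrite /rip ipDl ReD. Qed.

Lemma ripDr x y z : B x (y + z) = B x y + B x z.
Proof. by rewrite !(ripC x) ripDl. Qed.

Lemma ripZl r x y : B (r%:C *: x) y = r * B x y.
Proof. by rewrite /rip ipZl ReM /= mul0r subr0. Qed.

Lemma ripZr r x y : B x (r%:C *: y) = r * B x y.
Proof. by rewrite !(ripC x) ripZl. Qed.

Lemma ripNl x y : B (- x) y = - B x y.
Proof. by rewrite -scaleN1r /rip ipZl mulN1r ReN. Qed.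

Lemma ripNr x y : B x (- y) = - B x y.
Proof. by rewrite !(ripC x) ripNl. Qed.

Lemma ripBl x y z : B (x - y) z = B x z - B y z.
Proof. by rewrite ripDl ripNl. Qed.

Lemma rip0l y : B 0 y = 0. Proof. by rewrite /rip ip0l. Qed.
Lemma rip0r y : B y 0 = 0. Proof. by rewrite ripC rip0l. Qed.

Lemma rip_iZl x y : B ('i *: x) y = - complex.Im (ip x y).
Proof. by rewrite /rip ipZl ReM /= mul0r mul1r sub0r. Qed.

Lemma rip_iZlr x y : B ('i *: x) y = - B x ('i *: y).
Proof.
case: hH => _ S _ _ _; rewrite (ripC x) !rip_iZl S.
by case: (ip y x) => a b /=; rewrite !opprK.
Qed.

Definition ripE := (ripDl, ripDr, ripNl, ripNr, ripZl, ripZr).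

Lemma rip_ge0 x : 0 <= B x x.
Proof. by case: hH => _ _ P _ _; case: (P x). Qed.

Lemma rip_eq0 x : B x x = 0 -> x = 0.
Proof.
case: hH => _ _ P Z _ h; apply: Z; case: (P x) => hi _.
by move: h hi; rewrite /rip; case: (ip x x) => a b /= -> ->.
Qed.

Lemma hnorm_ge0 x : 0 <= hnorm x. Proof. exact: sqrtr_ge0. Qed.

Lemma hnorm_sqr x : hnorm x ^+ 2 = B x x.
Proof. by rewrite sqr_sqrtr // rip_ge0. Qed.

Lemma hnorm0 : hnorm 0 = 0.
Proof. by rewrite /Defs.hnorm ip0l sqrtr0. Qed.

Lemma hnorm_eq0 x : hnorm x = 0 -> x = 0.
Proof. by move=> h; apply: rip_eq0; rewrite -hnorm_sqr h expr0n. Qed.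

Lemma hnorm_le x (c : R) : 0 <= c -> B x x <= c ^+ 2 -> hnorm x <= c.
Proof. by move=> c0; rewrite -hnorm_sqr ler_sqr ?nnegrE ?hnorm_ge0. Qed.

Lemma rip_CS_sqr x y : B x y ^+ 2 <= B x x * B y y.
Proof.
have [y0|y0] := eqVneq (B y y) 0.
  by rewrite (rip_eq0 y0) !rip0r mulr0 expr0n.
have yp : 0 < B y y by rewrite lt_neqAle eq_sym y0 rip_ge0.
have := rip_ge0 ((B y y)%:C *: x - (B x y)%:C *: y).
rewrite !ripE (ripC y x) => h.
have : 0 <= B y y * (B x x * B y y - B x y ^+ 2) by lra.
by rewrite pmulr_rge0 // subr_ge0.
Qed.

Lemma rip_CS x y : `|B x y| <= hnorm x * hnorm y.
Proof.
rewrite -ler_sqr ?nnegrE ?mulr_ge0 ?hnorm_ge0 // real_normK ?num_real //.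
by rewrite exprMn !hnorm_sqr rip_CS_sqr.
Qed.

Lemma rip_CSr x y : B x y <= hnorm x * hnorm y.
Proof. exact: le_trans (ler_norm _) (rip_CS x y). Qed.

Lemma hnormD x y : hnorm (x + y) <= hnorm x + hnorm y.
Proof.
apply: hnorm_le; first by rewrite addr_ge0 ?hnorm_ge0.
rewrite !ripE (ripC y x) sqrrD !hnorm_sqr.
by have := rip_CSr x y; lra.
Qed.

Lemma hnormZ (c : R[i]) x : hnorm (c *: x) = nc c * hnorm x.
Proof.
apply/eqP; rewrite -(eqrXn2 (n := 2)) ?mulr_ge0 ?hnorm_ge0 ?cabs_ge0 //.
rewrite exprMn !hnorm_sqr cabs_sqr; apply/eqP.
have i1 u : B ('i *: u) u = 0.
  by have := rip_iZlr u u; rewrite (ripC u) => h; lra.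
have i2 u : B ('i *: u) ('i *: u) = B u u.
  by rewrite rip_iZlr scalerA -expr2 sqr_i scaleN1r ripNr opprK.
rewrite (scale_ReIm c x).
by rewrite !ripE i2 (ripC x) i1; ring.
Qed.

Lemma hnormN x : hnorm (- x) = hnorm x.
Proof. by rewrite -scaleN1r hnormZ cabsN cabs_real normr1 mul1r. Qed.

Lemma hnormB x y : hnorm (x - y) <= hnorm x + hnorm y.
Proof. by rewrite -(hnormN y) hnormD. Qed.

Lemma hnormZr (r : R) x : hnorm (r%:C *: x) = `|r| * hnorm x.
Proof. by rewrite hnormZ cabs_real. Qed.

Lemma rip_inj x y : (forall b, B x b = B y b) -> x = y.
Proof.
move=> h; apply/eqP; rewrite -subr_eq0; apply/eqP/rip_eq0.
by rewrite ripBl h subrr.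
Qed.

End HilbertSpace.

(** * Riesz representation of bounded real-linear functionals *)

Section Riesz.
Variables (R : realType) (H : lmodType R[i]) (ip : H -> H -> R[i]).
Hypothesis hH : is_hilbert ip.
Local Notation hnorm := (hnorm ip).
Local Notation B := (rip ip).

(** The representing vector is the minimiser of [J b = |b|^2 - 2 l b], which is bounded below by
    [- C^2]. Completeness gives the minimiser, and the first variation of [J] there is the claim. *)
Lemma riesz (l : H -> R) (C : R) :
  (forall x y, l (x + y) = l x + l y) -> (forall r x, l (r%:C *: x) = r * l x) ->
  (forall x, l x <= C * hnorm x) ->
  exists w, forall b, B w b = l b.
Proof.
move=> lD lZ lC.
pose J b := B b b - 2 * l b.
have J_ge b : - C ^+ 2 <= J b.
  have := lC b; have := sqr_ge0 (hnorm b - C).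
  by rewrite sqrrB /J -(hnorm_sqr hH); lra.
have lbJ : has_lbound (range J) by exists (- C ^+ 2) => _ [b _ <-].
have infJ : has_inf (range J) by split => //; exists (J 0), 0.
set d := inf (range J).
have Jd b : d <= J b by apply: ge_inf => //; exists b.
have [u uP] : {u : nat -> H & forall n, J (u n) < d + n.+1%:R^-1}.
  apply: (choice (P := fun n b => J b < d + n.+1%:R^-1)) => n.
  have n0 : 0 < n.+1%:R^-1 :> R by rewrite invr_gt0.
  by have [_ [b _ <-] hb] := inf_adherent n0 infJ; exists b.
(* Parallelogram law, with [J] at the midpoint bounded below by [d]: minimising sequences are
   Cauchy. *)
have par x y : B (x - y) (x - y) <= 2 * (J x + J y - 2 * d).
  have := Jd ((2^-1)%:C *: (x + y)).
  rewrite /J lZ lD !(ripE hH) (ripC hH y x) => h; lra.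
have small (e : R) : 0 < e -> exists N : nat, forall p, (N <= p)%N -> p.+1%:R^-1 < e.
  move=> e0; exists (Num.bound e^-1) => p hp.
  rewrite invf_plt ?posrE //.
  have e1 : 0 <= e^-1 by rewrite invr_ge0 ltW.
  by apply: (lt_le_trans (archi_boundP e1)); rewrite ler_nat ltnW.
have [w wP] : exists w, forall e, 0 < e -> exists N : nat, forall p, (N <= p)%N ->
    hnorm (u p - w) < e.
  case: hH => _ _ _ _; apply => e e0.
  have e4 : 0 < e ^+ 2 / 4 by rewrite divr_gt0 ?exprn_gt0.
  have [N NP] := small _ e4; exists N => p q hp hq.
  rewrite -ltr_sqr ?nnegrE ?(hnorm_ge0 ip) ?ltW // (hnorm_sqr hH).
  apply: le_lt_trans (par _ _) _.
  move: (NP _ hp) (NP _ hq) (uP p) (uP q); move: (p.+1%:R^-1) (q.+1%:R^-1) => ip1 iq1.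
  by move: (e ^+ 2) => e2; lra.
exists w => b.
(* Limit along [u] of [J (u p + t b) >= d > J (u p) - 1/(p+1)]. The quantity [c] makes the error of
   replacing [u p] by [w] at most [e / 2]. *)
have key (t : R) : 0 <= t ^+ 2 * B b b + 2 * t * (B w b - l b).
  apply/ler_addgt0Pr => e e0.
  set c := 2 * `|t| * hnorm b + 1.
  have c0 : 0 < c by rewrite /c ltr_wpDl // !mulr_ge0 ?(hnorm_ge0 ip).
  have [N1 N1P] := wP (e / 2 / c) (divr_gt0 (divr_gt0 e0 (ltr0n _ 2)) c0).
  have [N2 N2P] := small (e / 2) (divr_gt0 e0 (ltr0n _ 2)).
  set p := maxn N1 N2.
  have := N1P p (leq_maxl _ _); have := N2P p (leq_maxr _ _); have := uP p.
  have := Jd (u p + t%:C *: b).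
  rewrite /J lD lZ !(ripE hH) (ripC hH b) => h1 h2 h3 h4.
  have h5 : 2 * t * B (u p - w) b <= e / 2.
    apply: le_trans (ler_norm _) _; rewrite !normrM ger0_norm //.
    have hc : hnorm (u p - w) * c <= e / 2 by rewrite -ler_pdivlMr // ltW.
    apply: le_trans hc.
    have := rip_CS hH (u p - w) b; have := hnorm_ge0 ip (u p - w).
    move: (hnorm (u p - w)) (`|_|) => r s r0 hs.
    rewrite /c; have := ler_wpM2l (mulr_ge0 (ler0n _ 2) (normr_ge0 t)) hs.
    by lra.
  move: h1 h2 h3 h5; rewrite (ripBl hH); move: (p.+1%:R^-1) => ip1; lra.
set g := B w b - l b in key.
have g0 : g = 0.
  have n0 := rip_ge0 hH b; set n := B b b in n0 key.
  have n1 : 0 < n + 1 by rewrite ltr_wpDl.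
  (* Dividing by [n + 1] instead of the optimal [n] also covers [b = 0] and still yields a negative
     multiple of [g^2]. *)
  have := key (- g / (n + 1)).
  have -> : (- g / (n + 1)) ^+ 2 * n + 2 * (- g / (n + 1)) * g =
            - (g ^+ 2 * ((n + 2) / (n + 1) ^+ 2)).
    by field; rewrite gt_eqF.
  rewrite oppr_ge0 pmulr_lle0 ?divr_gt0 ?exprn_gt0 //; last by rewrite ltr_wpDl.
  by move=> hg; apply/eqP; rewrite -sqrf_eq0 eq_le hg sqr_ge0.
by apply/eqP; rewrite -subr_eq0 -/g g0.
Qed.

End Riesz.

(** * Norm estimates for two real projections at a positive angle *)

Section RealProjections.
Variables (R : realType) (H : lmodType R[i]) (ip : H -> H -> R[i]).
Hypothesis hH : is_hilbert ip.
Local Notation hnorm := (hnorm ip).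
Local Notation B := (rip ip).

Section OneProjection.
Variable P : H -> H.
Hypothesis hP : real_orth_proj ip P.

Lemma projD x y : P (x + y) = P x + P y. Proof. by case: hP. Qed.
Lemma projZ r x : P (r%:C *: x) = r%:C *: P x. Proof. by case: hP. Qed.
Lemma projK x : P (P x) = P x. Proof. by case: hP. Qed.
Lemma proj_adj x y : B (P x) y = B x (P y). Proof. by case: hP => _ _ _; apply. Qed.

Lemma proj0 : P 0 = 0.
Proof. by apply: (addrI (P 0)); rewrite -projD !addr0. Qed.

Lemma proj_le_norm x : hnorm (P x) <= hnorm x.
Proof.
have [z|nz] := eqVneq (hnorm (P x)) 0; first by rewrite z (hnorm_ge0 ip).
have pz : 0 < hnorm (P x) by rewrite lt_neqAle eq_sym nz (hnorm_ge0 ip).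
rewrite -(ler_pM2l pz) -expr2 (hnorm_sqr hH) proj_adj projK -proj_adj.
exact: rip_CSr.
Qed.

End OneProjection.

Variables E F : H -> H.
Hypotheses (hE : real_orth_proj ip E) (hF : real_orth_proj ip F).
Variable c : R.
Hypotheses (c0 : 0 < c) (c1 : c < 1).
Hypothesis angle : forall x y, B (E x) (F y) <= c * (hnorm (E x) * hnorm (F y)).

(** Selfadjointness gives |EFx|^2 = <EFx, Fx>, to which [angle] applies; one factor |EFx| then
    cancels. *)
Lemma proj_comp_norm x : hnorm (E (F x)) <= c * hnorm (F x).
Proof.
have [z|nz] := eqVneq (hnorm (E (F x))) 0.
  by rewrite z mulr_ge0 ?(hnorm_ge0 ip) ?ltW.
have pz : 0 < hnorm (E (F x)) by rewrite lt_neqAle eq_sym nz (hnorm_ge0 ip).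
rewrite -(ler_pM2l pz) -expr2 (hnorm_sqr hH) (proj_adj hE) (projK hE) -(proj_adj hE).
rewrite [leRHS]mulrCA -{1}(projK hF x).
by have := angle (F x) (F x); rewrite (projK hF).
Qed.

Lemma meet_trivial K : is_meet ip E F K -> forall x, K x = 0.
Proof.
move=> [hK KP] x.
have [[y Ey] [z Fz]] := (KP (K x)).1 (ex_intro _ x erefl).
have EK : E (K x) = K x by rewrite -{1}Ey (projK hE).
have FK : F (K x) = K x by rewrite -{1}Fz (projK hF).
apply: (hnorm_eq0 hH); have := angle (K x) (K x); rewrite EK FK -(hnorm_sqr hH).
have := hnorm_ge0 ip (K x); set n := hnorm (K x) => n0 h.
have : (1 - c) * n ^+ 2 <= 0 by rewrite expr2 in h *; lra.
rewrite pmulr_rle0 ?subr_gt0 // => h'.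
by apply/eqP; rewrite -sqrf_eq0 eq_le h' sqr_ge0.
Qed.

(* On the pair (a, b) the operator E + F - 1 acts through T (a, b) = (E b, F a),
   with |T| <= c; the claim is (c^2 - T^2)(1 + T) >= 0 for the Gram form 1 + T,
   which follows from
   (c^2 - T^2)(1 + T) = (1 - c)(c^2 - T^2) + (c + T)(c - T)(c + T). *)
Lemma sum_norm a b : E a = a -> F b = b ->
  hnorm (E b + F a) <= c * hnorm (a + b).
Proof.
move=> Ea Fb.
apply: (hnorm_le hH); first by rewrite mulr_ge0 ?(hnorm_ge0 ip) ?ltW.
rewrite exprMn (hnorm_sqr hH).
have EbN : hnorm (E b) ^+ 2 <= c ^+ 2 * hnorm b ^+ 2.
  rewrite -exprMn ler_sqr ?nnegrE ?mulr_ge0 ?(hnorm_ge0 ip) ?(ltW c0) //.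
  by have := proj_comp_norm b; rewrite Fb.
have FaN : hnorm (F a) ^+ 2 <= c ^+ 2 * hnorm a ^+ 2.
  rewrite -exprMn ler_sqr ?nnegrE ?mulr_ge0 ?(hnorm_ge0 ip) ?(ltW c0) //.
  have [z|nz] := eqVneq (hnorm (F a)) 0.
    by rewrite z mulr_ge0 ?(hnorm_ge0 ip) ?ltW.
  have pz : 0 < hnorm (F a) by rewrite lt_neqAle eq_sym nz (hnorm_ge0 ip).
  rewrite -(ler_pM2l pz) -expr2 (hnorm_sqr hH) (proj_adj hF) (projK hF).
  by have := angle a a; rewrite Ea [hnorm a * _]mulrC mulrCA.
(* Positivity of [c - T] at the pair [(c + T) (a, b)], the second summand of the identity. It is
   [angle] at [c a + b] and [c b + a], whose images under E and F are the entries of that pair.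
   [EbN] and [FaN] together give the first summand. *)
have W : B (c%:C *: a + E b) (c%:C *: b + F a) <=
    c / 2 * (hnorm (c%:C *: a + E b) ^+ 2 + hnorm (c%:C *: b + F a) ^+ 2).
  have := angle (c%:C *: a + b) (c%:C *: b + a).
  rewrite (projD hE) (projD hF) (projZ hE) (projZ hF) Ea Fb.
  set p := hnorm _; set q := hnorm _.
  move=> /le_trans; apply; rewrite -mulrA ler_pM2l //.
  by have := sqr_ge0 (p - q); rewrite sqrrB; lra.
move: W EbN FaN; rewrite !(hnorm_sqr hH) !(ripE hH).
have e1 : B a (E b) = B a b by rewrite -(proj_adj hE) Ea.
have e2 : B b (F a) = B a b by rewrite -(proj_adj hF) Fb (ripC hH).
have e3 : B (E b) b = B (E b) (E b) by rewrite -(proj_adj hE) (projK hE).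
have e4 : B a (F a) = B (F a) (F a) by rewrite (proj_adj hF) (projK hF).
rewrite (ripC hH (E b) a) (ripC hH (F a) b) (ripC hH b a) (ripC hH (F a) (E b)) e1 e2 e3 e4.
move: (B a a) (B b b) (B a b) (B (E b) (E b)) (B (F a) (F a)) (B (E b) (F a)).
move=> aa bb ab ebeb fafa ebfa W h1 h2.
have c1' : 0 <= 1 - c by rewrite subr_ge0 ltW.
have := ler_wpM2l c1' h1; have := ler_wpM2l c1' h2; move: W; rewrite expr2.
nra.
Qed.

(** Since [E J = E] and [F J = F], it suffices to test vectors of the range of [J]. These are limits
    of sums [E a + F b], on which E + F - 1 acts as [(E a, F b) |-> E (F b) + F (E a)], and
    [sum_norm] applies. *)
Lemma join_norm J : is_join ip E F J ->
  op_norm_le ip (fun x => E x + F x - J x) c.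
Proof.
move=> [hJ JP] x.
have JE y : J (E y) = E y.
  have [|z <-] := (JP (E y)).2; last by rewrite (projK hJ).
  move=> e e0; exists y, 0.
  by rewrite (proj0 hF) addr0 subrr (hnorm0 hH).
have JF y : J (F y) = F y.
  have [|z <-] := (JP (F y)).2; last by rewrite (projK hJ).
  move=> e e0; exists 0, y.
  by rewrite (proj0 hE) add0r subrr (hnorm0 hH).
have EJ y : E (J y) = E y.
  by apply: (rip_inj hH) => b; rewrite (proj_adj hE) (proj_adj hJ) JE (proj_adj hE).
have FJ y : F (J y) = F y.
  by apply: (rip_inj hH) => b; rewrite (proj_adj hF) (proj_adj hJ) JF (proj_adj hF).
rewrite -(EJ x) -(FJ x).
apply: (@le_trans _ _ (c * hnorm (J x))); last first.
  by rewrite ler_pM2l // proj_le_norm.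
have := (JP (J x)).1 (ex_intro _ x erefl).
move: (J x) => u uP.
apply/ler_addgt0Pr => e e0.
(* The remainder [r] costs [3 |r|] through E + F - 1 and [c |r| <= |r|] through the norm of
   [E a + F b]. *)
have [a [b hab]] := uP (e / 4) (divr_gt0 e0 (ltr0n _ 4)).
set r := u - (E a + F b) in hab.
have ur : u = E a + F b + r by rewrite /r addrC subrK.
have -> : E u + F u - u = (E (F b) + F (E a)) + (E r + F r - r).
  rewrite ur !(projD hE) !(projD hF) (projK hE) (projK hF).
  by apply: (rip_inj hH) => v; rewrite !(ripE hH); ring.
apply: le_trans (hnormD hH _ _) _.
have s := sum_norm (projK hE a) (projK hF b).
have n1 : hnorm (E a + F b) <= hnorm u + hnorm r.
  by rewrite -[E a + F b](addrK r) -ur hnormB.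
have n2 : hnorm (E r + F r - r) <= 3 * hnorm r.
  apply: le_trans (hnormB hH _ _) _; apply: le_trans (lerD (hnormD hH _ _) (lexx _)) _.
  by have := proj_le_norm hE r; have := proj_le_norm hF r; lra.
have := ler_wpM2l (ltW c0) n1.
have : c * hnorm r <= hnorm r by rewrite ler_piMl ?(hnorm_ge0 ip) // ltW.
lra.
Qed.

End RealProjections.

(** * Dominated integrals on the line *)

Section DominatedIntegrals.
Variable R : realType.
Local Notation mu := (@lebesgue_measure R).
Implicit Types g h : R -> R.

Lemma integral_cauchy_density :
  (\int[mu]_x ((oneDsqr x)^-1)%:E = pi%:E)%E.
Proof.
rewrite ge0_symfun_integralT.
- rewrite -set_itvcy integral0y_oneDsqr -EFinM; congr _%:E.
  by field.
- by move=> x; rewrite invr_ge0 (le_trans ler01) // oneDsqr_ge1.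
- exact: continuous_oneDsqrV.
- by move=> x; rewrite /= /oneDsqr sqrrN.
Qed.

Lemma measurable_cauchy_density :
  measurable_fun setT (fun x : R => (oneDsqr x)^-1).
Proof. by apply: continuous_measurable_fun; exact: continuous_oneDsqrV. Qed.

Lemma integrable_cauchy_density :
  mu.-integrable setT (EFin \o (fun x : R => (oneDsqr x)^-1)).
Proof.
apply/integrableP; split.
  by apply/measurable_EFinP; exact: measurable_cauchy_density.
under eq_integral => x _.
  rewrite /= ger0_norm; last by rewrite invr_ge0 (le_trans ler01) // oneDsqr_ge1.
  over.
by rewrite integral_cauchy_density ltry.
Qed.

(** One fixed integrable majorant, of total mass pi, serves every integral over the line: it gives
    integrability and explicit bounds, and it is stable under translation up to a constant. *)
Definition cauchy_dominated g : Prop :=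
  measurable_fun setT g /\ exists M, forall x, `|g x| <= M * (oneDsqr x)^-1.

Lemma cauchy_dominated_integrable g :
  cauchy_dominated g -> mu.-integrable setT (EFin \o g).
Proof.
move=> [mg [M gM]].
apply: (@le_integrable _ _ _ mu setT measurableT _
  (EFin \o (fun x : R => M * (oneDsqr x)^-1)%R)).
- exact/measurable_EFinP.
- move=> x _ /=; rewrite lee_fin (le_trans (gM x)) //; exact: ler_norm.
- rewrite (_ : _ \o _ = (fun x => M%:E * (EFin \o (fun x : R => (oneDsqr x)^-1)%R) x)%E) //.
  exact: (integrableZl measurableT M integrable_cauchy_density).
Qed.

Lemma Rintegral_cauchy_density M :
  \int[mu]_x (M * (oneDsqr x)^-1) = M * pi.
Proof.
rewrite RintegralZl // ?integrable_cauchy_density //.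
by rewrite /Rintegral integral_cauchy_density.
Qed.

Lemma cauchy_dominated_Rintegral_le g M : measurable_fun setT g ->
  (forall x, `|g x| <= M * (oneDsqr x)^-1) -> `|\int[mu]_x g x| <= M * pi.
Proof.
move=> mg gM.
have ig : mu.-integrable setT (EFin \o g).
  by apply: cauchy_dominated_integrable; split => //; exists M.
apply: le_trans (le_normr_Rintegral measurableT ig) _.
rewrite -Rintegral_cauchy_density; apply: le_Rintegral => //.
- apply: cauchy_dominated_integrable; split.
    exact: measurableT_comp.
  by exists M => x; rewrite normr_id.
- apply: cauchy_dominated_integrable; split.
    apply: measurable_funM; [exact: measurable_cst|exact: measurable_cauchy_density].
  exists `|M| => x; rewrite normrM ler_wpM2l // ger0_norm //.
Qed.

Lemma lebesgue_measure_translation (t : R) (A : set R) : measurable A ->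
  pushforward mu ((fun x => x + t) : measurableTypeR R -> measurableTypeR R) A = mu A.
Proof.
move=> mA.
have mt : measurable_fun setT ((fun x => x + t) : measurableTypeR R -> measurableTypeR R).
  exact: measurable_funD.
apply/esym/lebesgue_measure_unique => //= _ [[a b]] _ <-.
rewrite /pushforward.
rewrite (_ : _ @^-1` _ = [set` `]a - t, b - t]%R]).
  by rewrite !lebesgue_measure_itv /= !lte_fin ltrD2r -!EFinB opprB addrA subrK.
by apply/seteqP; split => x /=; rewrite !in_itv /= ltrBlDr lerBrDr.
Qed.

Lemma Rintegral_translation g (t : R) : cauchy_dominated (fun x => g (x + t)) ->
  measurable_fun setT g ->
  \int[mu]_x g (x + t) = \int[mu]_x g x.
Proof.
move=> dg mg; rewrite /Rintegral; congr fine.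
have mt : measurable_fun setT ((fun x => x + t) : measurableTypeR R -> measurableTypeR R).
  exact: measurable_funD.
have := @integral_pushforward _ _ _ _ R _ mt mu setT (EFin \o g).
rewrite preimage_setT => /(_ _ _ measurableT) <-.
- by apply: eq_measure_integral => A mA _; exact: lebesgue_measure_translation.
- exact/measurable_EFinP.
- exact: cauchy_dominated_integrable dg.
Qed.

End DominatedIntegrals.

(** * Weak integrals along the unitary orbit *)

Section OrbitIntegrals.
Variables (R : realType) (H : lmodType R[i]) (ip : H -> H -> R[i]).
Hypothesis hH : is_hilbert ip.
Local Notation hnorm := (hnorm ip).
Local Notation B := (rip ip).
Local Notation mu := (@lebesgue_measure R).
Variable V : R -> H -> H.
Hypothesis hV : unitary_group ip V.

Lemma unitaryD t x y : V t (x + y) = V t x + V t y.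
Proof. by case: hV => L _ _ _ _; have := L t 1 x y; rewrite !scale1r. Qed.

Lemma unitary0 t : V t 0 = 0.
Proof. by apply: (addrI (V t 0)); rewrite -unitaryD !addr0. Qed.

Lemma unitaryZ t c x : V t (c *: x) = c *: V t x.
Proof. by case: hV => L _ _ _ _; have := L t c x 0; rewrite unitary0 !addr0. Qed.

Lemma unitary_rip t x y : B (V t x) (V t y) = B x y.
Proof. by case: hV => _ U _ _ _; rewrite /rip U. Qed.

Lemma unitary_hnorm t x : hnorm (V t x) = hnorm x.
Proof. by case: hV => _ U _ _ _; rewrite /Defs.hnorm U. Qed.

Lemma unitaryDt s t x : V (s + t) x = V s (V t x).
Proof. by case: hV. Qed.

Lemma unitaryNK t x : V t (V (- t) x) = x.
Proof. by case: hV => _ _ V0 _ _; rewrite -unitaryDt subrr V0. Qed.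

Lemma unitary_rip_adj t x y : B (V t x) y = B x (V (- t) y).
Proof. by rewrite -{1}(unitaryNK t y) unitary_rip. Qed.

Lemma orbit_continuous a b : continuous (fun x => B (V x a) b).
Proof.
case: hV => _ _ _ _ Vc x0.
apply/(@cvgrPdist_lt _ R) => e e0.
have b0 : 0 < hnorm b + 1 by rewrite ltr_wpDl // (hnorm_ge0 ip).
have [d d0 dP] := Vc a x0 (e / (hnorm b + 1)) (divr_gt0 e0 b0).
exists d => //= t htd; have := dP t; rewrite distrC => /(_ htd).
rewrite ltr_pdivlMr // => h.
rewrite distrC -(ripBl hH); apply: le_lt_trans (rip_CS hH _ _) _.
apply: le_lt_trans h; rewrite ler_wpM2l ?(hnorm_ge0 ip) ?lerDl ?ler01 //.
Qed.

Lemma rip_conjl c x y : B (c *: x) y = B x (conjc c *: y).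
Proof.
rewrite (scale_ReIm c) (scale_ReIm (conjc c)) !(ripE hH) (rip_iZlr hH).
by case: c => u v /=; ring.
Qed.

Definition cdominated (psi : R -> R[i]) (M : R) : Prop :=
  [/\ measurable_fun setT (fun x => complex.Re (psi x)),
      measurable_fun setT (fun x => complex.Im (psi x)) &
      forall x, cabs (psi x) <= M * (oneDsqr x)^-1].

Variable a : H.

Lemma orbit_integrand_measurable psi M b : cdominated psi M ->
  measurable_fun setT (fun x => B (psi x *: V x a) b).
Proof.
move=> [mr mi _].
rewrite (_ : (fun _ => _) = (fun x => complex.Re (psi x) * B (V x a) b
   + complex.Im (psi x) * B (V x ('i *: a)) b)).
  apply: measurable_funD; apply: measurable_funM => //;
    by apply: continuous_measurable_fun; exact: orbit_continuous.
apply/funext => x; rewrite unitaryZ.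
by rewrite (scale_ReIm (psi x)) !(ripE hH).
Qed.

Lemma orbit_integrand_le psi M b : cdominated psi M ->
  forall x, `|B (psi x *: V x a) b| <= M * hnorm a * hnorm b * (oneDsqr x)^-1.
Proof.
move=> [_ _ hM] x; apply: le_trans (rip_CS hH _ _) _.
rewrite (hnormZ hH) unitary_hnorm.
rewrite [leRHS](_ : _ = M * (oneDsqr x)^-1 * hnorm a * hnorm b); last by ring.
by rewrite !ler_wpM2r ?(hnorm_ge0 ip).
Qed.

Lemma orbit_integrand_dominated psi M b : cdominated psi M ->
  cauchy_dominated (fun x => B (psi x *: V x a) b).
Proof.
move=> h; split; first exact: orbit_integrand_measurable h.
by exists (M * hnorm a * hnorm b); exact: orbit_integrand_le.
Qed.

(** The Pettis integral of [psi x *: V x a], tested against the real inner product only. This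
    determines [v] by [rip_inj], and replacing [b] by a multiple of 'i recovers the imaginary
    parts. *)
Definition orbit_integral (psi : R -> R[i]) (v : H) : Prop :=
  forall b, B v b = \int[mu]_x B (psi x *: V x a) b.

Lemma orbit_integral_exists psi M : cdominated psi M ->
  exists v, orbit_integral psi v.
Proof.
move=> h; have I b := cauchy_dominated_integrable (orbit_integrand_dominated b h).
apply: (@riesz _ _ _ hH _ (M * pi * hnorm a)).
- move=> b c; rewrite -RintegralD //.
  by apply: eq_Rintegral => x _; rewrite (ripDr hH).
- move=> r b; rewrite -RintegralZl //.
  by apply: eq_Rintegral => x _; rewrite (ripZr hH).
- move=> b; apply: le_trans (ler_norm _) _.
  have := cauchy_dominated_Rintegral_le (orbit_integrand_measurable b h)
    (orbit_integrand_le b h).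
  by move=> /le_trans; apply; rewrite le_eqVlt; apply/orP; left; apply/eqP; ring.
Qed.

Lemma orbit_integral_norm psi M v : cdominated psi M -> orbit_integral psi v ->
  hnorm v <= M * pi * hnorm a.
Proof.
move=> h hv.
have [z|nz] := eqVneq (hnorm v) 0.
  rewrite z !mulr_ge0 ?(hnorm_ge0 ip) ?pi_ge0 //.
  by case: h => _ _ /(_ 0); rewrite /oneDsqr expr0n addr0 invr1 mulr1 => /(le_trans _); apply; exact: cabs_ge0.
have pz : 0 < hnorm v by rewrite lt_neqAle eq_sym nz (hnorm_ge0 ip).
rewrite -(ler_pM2r pz) -expr2 (hnorm_sqr hH) hv; apply: le_trans (ler_norm _) _.
have := cauchy_dominated_Rintegral_le (orbit_integrand_measurable v h)
    (orbit_integrand_le v h).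
by move=> /le_trans; apply; rewrite le_eqVlt; apply/orP; left; apply/eqP; ring.
Qed.

Lemma orbit_integral_uniq psi v w : orbit_integral psi v -> orbit_integral psi w -> v = w.
Proof. by move=> hv hw; apply: (rip_inj hH) => b; rewrite hv hw. Qed.

Lemma orbit_integralD psi phi M N v w c :
  cdominated psi M -> cdominated phi N ->
  orbit_integral psi v -> orbit_integral phi w ->
  orbit_integral (fun x => psi x + c * phi x) (v + c *: w).
Proof.
move=> hp hq hv hw b.
rewrite (ripDl hH) rip_conjl hv hw -RintegralD //.
- by apply: eq_Rintegral => x _; rewrite scalerDl (ripDl hH) -scalerA (rip_conjl c).
- exact: cauchy_dominated_integrable (orbit_integrand_dominated _ hp).
- exact: cauchy_dominated_integrable (orbit_integrand_dominated _ hq).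
Qed.

(** By the group law and translation invariance of Lebesgue measure, acting with [V t] on an average
    amounts to translating its weight. This makes averages differentiable along the group. *)
Lemma orbit_integral_shift psi M N t v :
  cdominated psi M -> cdominated (fun x => psi (x - t)) N ->
  orbit_integral psi v -> orbit_integral (fun x => psi (x - t)) (V t v).
Proof.
move=> hp hq hv b; rewrite unitary_rip_adj hv.
have e x : B (psi x *: V x a) (V (- t) b) = B (psi (x + t - t) *: V (x + t) a) b.
  by rewrite -unitary_rip_adj unitaryZ -unitaryDt addrK [t + x]addrC.
under eq_Rintegral => x _ do rewrite e.
apply: (@Rintegral_translation R (fun x => B (psi (x - t) *: V x a) b) t).
  rewrite (_ : (fun _ => _) = (fun x => B (psi x *: V x a) (V (- t) b))).
    exact: orbit_integrand_dominated hp.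
  by apply/funext => x; rewrite -e.
exact: orbit_integrand_measurable hq.
Qed.

End OrbitIntegrals.

(** A discrete Gronwall argument: [N y * e^{-2m(y - y0)}] decreases by at most [C1 * h^2] over a
    step of length [h], so the total loss over n equal steps is of order 1/n. This replaces the
    inequality N' >= 2 m N and needs no derivative of [N]. *)
Lemma exp_growth (R : realType) (N : R -> R) (y0 y1 m C D h0 : R) :
  0 < m -> 0 < h0 -> y0 < y1 -> 0 <= C ->
  (forall y, y0 <= y <= y1 -> 0 <= N y <= D) ->
  (forall y h, y0 <= y -> 0 < h <= h0 -> y + h <= y1 ->
     N y * (1 + 2 * m * h) - C * h ^+ 2 <= N (y + h)) ->
  N y0 * expR (2 * m * (y1 - y0)) <= N y1.
Proof.
move=> m0 h00 y01 C0 ND step.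
pose G y := N y * expR (- (2 * m * (y - y0))).
(* With [t = 2 m h], multiplying [1 + t] by [e^{-t} >= 1 - t] loses at most
   [t^2 N <= 4 m^2 D h^2]. *)
pose C1 := C + 4 * m ^+ 2 * D.
have L0 : 0 < y1 - y0 by rewrite subr_gt0.
have D0 : 0 <= D.
  have /andP[a b] : 0 <= N y0 <= D by apply: ND; rewrite lexx ltW.
  exact: le_trans b.
have C10 : 0 <= C1 by rewrite addr_ge0 // !mulr_ge0 // ltW.
have Gstep y h : y0 <= y -> 0 < h <= h0 -> y + h <= y1 ->
    G y - C1 * h ^+ 2 <= G (y + h).
  move=> hy hh hyh; have := step y h hy hh hyh.
  move: hh => /andP[hp hh].
  have /andP[N0 N1] : 0 <= N y <= D.
    by apply: ND; rewrite hy /= (le_trans _ hyh) // lerDl ltW.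
  set t := 2 * m * h; have t0 : 0 < t by rewrite !mulr_gt0.
  rewrite /G (_ : - (2 * m * (y + h - y0)) = - (2 * m * (y - y0)) + - t); last by rewrite /t; ring.
  rewrite expRD.
  set E := expR (- (2 * m * _)); set e := expR (- t).
  have E0 : 0 < E by exact: expR_gt0.
  have E1 : E <= 1 by rewrite -expR0 ler_expR oppr_le0 !mulr_ge0 ?subr_ge0 // ltW.
  have e0 : 0 < e by exact: expR_gt0.
  have e1 : e <= 1 by rewrite -expR0 ler_expR oppr_le0 ltW.
  have et : 1 - t <= e by exact: expR_ge1Dx.
  move=> hst.
  have s1 : (N y * (1 + t) - C * h ^+ 2) * e <= N (y + h) * e by rewrite ler_pM2r.
  have s2 : N y - C1 * h ^+ 2 <= (N y * (1 + t) - C * h ^+ 2) * e.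
    have a1 : N y * (1 + t) * (1 - t) <= N y * (1 + t) * e.
      by rewrite ler_wpM2l // mulr_ge0 // addr_ge0 // ltW.
    have a2 : C * h ^+ 2 * e <= C * h ^+ 2 by rewrite ler_piMr // mulr_ge0 // sqr_ge0.
    have a3 : N y * t ^+ 2 <= D * t ^+ 2 by rewrite ler_wpM2r // sqr_ge0.
    have a4 : t ^+ 2 = 4 * m ^+ 2 * h ^+ 2 by rewrite /t; ring.
    by rewrite /C1; move: a1 a3; rewrite a4; move: a2; rewrite -a4; nra.
  have s3 : (N y - C1 * h ^+ 2) * E <= N (y + h) * e * E.
    by rewrite ler_pM2r // (le_trans s2).
  have s4 : C1 * h ^+ 2 * E <= C1 * h ^+ 2 by rewrite ler_piMr // mulr_ge0 // sqr_ge0.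
  by rewrite [E * e]mulrC mulrA; lra.
have Gmain : G y0 <= G y1.
  apply/ler_addgt0Pr => eps eps0.
  set L := y1 - y0 in L0.
  (* The first bound makes the step [L / n] admissible, the second makes the accumulated loss
     [C1 * L^2 / n] at most [eps]. *)
  pose n := (Num.bound (Num.max (L / h0) (C1 * L ^+ 2 / eps))).+1.
  have bn : Num.max (L / h0) (C1 * L ^+ 2 / eps) < n%:R.
    apply: (lt_trans (archi_boundP _)); last by rewrite ltr_nat.
    by rewrite le_max divr_ge0 // ltW.
  have n0 : 0 < n%:R :> R by rewrite ltr0n.
  pose h := L / n%:R.
  have h1 : 0 < h <= h0.
    rewrite divr_gt0 //= ler_pdivrMr // mulrC -ler_pdivrMr // ltW //.
    by apply: le_lt_trans bn; rewrite le_max lexx.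
  have it k : (k <= n)%N -> G y0 - k%:R * (C1 * h ^+ 2) <= G (y0 + k%:R * h).
    elim: k => [|k ih kn]; first by rewrite !mul0r subr0 addr0.
    have hp : 0 <= h by case/andP: h1 => /ltW.
    have k1 : y0 <= y0 + k%:R * h by rewrite lerDl mulr_ge0.
    have k2 : y0 + k%:R * h + h <= y1.
      rewrite -addrA -lerBrDl -/L -[X in _ + X]mul1r -mulrDl natr1 /h mulrCA.
      by rewrite ger_pMr // ler_pdivrMr // mul1r ler_nat.
    have := ih (ltnW kn); have := Gstep _ _ k1 h1 k2.
    by rewrite -natr1 (_ : y0 + (k%:R + 1) * h = y0 + k%:R * h + h); [lra|ring].
  have := it n (leqnn n).
  have -> : y0 + n%:R * h = y1 by rewrite /h mulrC divfK ?gt_eqF // /L addrC subrK.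
  have : n%:R * (C1 * h ^+ 2) <= eps.
    have -> : n%:R * (C1 * h ^+ 2) = C1 * L ^+ 2 / n%:R by rewrite /h; field; rewrite gt_eqF.
    rewrite ler_pdivrMr // [leRHS]mulrC -ler_pdivrMr // ltW //.
    by apply: le_lt_trans bn; rewrite le_max lexx orbT.
  lra.
move: Gmain; rewrite /G subrr mulr0 oppr0 expR0 mulr1 => h.
by rewrite -ler_pdivlMr ?expR_gt0 // -expRN.
Qed.

Section DominatedComplex.
Variable R : realType.
Implicit Types psi phi : R -> R[i].

Lemma oneDsqr_gt0 (x : R) : 0 < oneDsqr x.
Proof. exact: lt_le_trans ltr01 (oneDsqr_ge1 x). Qed.

Lemma oneDsqrV_ge0 (x : R) : 0 <= (oneDsqr x)^-1.
Proof. by rewrite invr_ge0 ltW // oneDsqr_gt0. Qed.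

Lemma cdominated_bound psi M N : cdominated psi M ->
  (forall x, cabs (psi x) <= N * (oneDsqr x)^-1) -> cdominated psi N.
Proof. by case=> mr mi _ h; split. Qed.

Lemma cdominatedD psi phi M N c : cdominated psi M -> cdominated phi N ->
  cdominated (fun x => psi x + c * phi x) (M + cabs c * N).
Proof.
move=> [pr pi pM] [qr qi qN]; split.
- rewrite (_ : (fun _ => _) = (fun x => complex.Re (psi x) +
    (complex.Re c * complex.Re (phi x) - complex.Im c * complex.Im (phi x)))).
    apply: measurable_funD => //; apply: measurable_funB;
      by apply: measurable_funM => //; exact: measurable_cst.
  by apply/funext => x; rewrite ReD ReM.
- rewrite (_ : (fun _ => _) = (fun x => complex.Im (psi x) +
    (complex.Re c * complex.Im (phi x) + complex.Im c * complex.Re (phi x)))).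
    apply: measurable_funD => //; apply: measurable_funD;
      by apply: measurable_funM => //; exact: measurable_cst.
  by apply/funext => x; rewrite ImD ImM.
- move=> x; apply: le_trans (cabsD _ _) _; rewrite cabsM mulrDl lerD //.
  by rewrite -mulrA ler_wpM2l ?cabs_ge0.
Qed.

(** The constant comes from 1 + x^2 <= 2 (1 + t^2) (1 + (x - t)^2), that is, from the squares of x -
    2t and t(x - t). *)
Lemma cdominated_shift psi M t : cdominated psi M ->
  cdominated (fun x => psi (x - t)) (2 * oneDsqr t * M).
Proof.
move=> [mr mi pM].
have ms : measurable_fun setT (fun x : R => x - t).
  by apply: measurable_funB => //; exact: measurable_cst.
split.
- exact: (measurableT_comp mr ms).
- exact: (measurableT_comp mi ms).
- move=> x; apply: le_trans (pM _) _.
  have M0 : 0 <= M.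
    by have := pM 0; rewrite /oneDsqr expr0n addr0 invr1 mulr1 => /(le_trans _); apply; exact: cabs_ge0.
  rewrite [leRHS](_ : _ = M * (2 * oneDsqr t * (oneDsqr x)^-1)); last by ring.
  rewrite ler_wpM2l // ler_pdivlMr ?oneDsqr_gt0 // mulrC ler_pdivrMr ?oneDsqr_gt0 //.
  rewrite /oneDsqr.
  have := sqr_ge0 (x - 2 * t); have := sqr_ge0 (t * (x - t)); lra.
Qed.

End DominatedComplex.

(** * Vanishing of the averages of an orbit against an analytic kernel *)

Section KernelVanishing.
Variables (R : realType) (H : lmodType R[i]) (ip : H -> H -> R[i]).
Hypothesis hH : is_hilbert ip.
Local Notation hnorm := (hnorm ip).
Local Notation B := (rip ip).
Variable V : R -> H -> H.
Hypothesis hV : unitary_group ip V.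
Variable m : R.
Hypotheses (m_gt0 : 0 < m) (hQ : generator_ge ip V m).

Variables (K K' : R[i] -> R[i]) (m' M : R).
Hypothesis m'm : m' < m.
Hypothesis Kdom : forall y : R, 0 < y ->
  cdominated (fun x => K (x +i* y)) (M * expR (m' * y)).
Hypothesis Ktaylor : forall y0 y1 : R, 0 < y0 -> y0 < y1 -> exists h0 N : R, 0 < h0 /\
  forall y : R, y0 <= y <= y1 ->
    cdominated (fun x => K' (x +i* y)) N /\
    forall (x : R) h, cabs h <= h0 ->
      cabs (K (x +i* y + h) - K (x +i* y) - h * K' (x +i* y))
        <= N * cabs h ^+ 2 * (oneDsqr x)^-1.

Variable a : H.

(* Along w(y) = \int K(x + iy) V(x)a dx the vertical derivative of K gives
   w' = Q w, so Q >= m forces growth e^{my}, faster than the bound e^{m'y}. *)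
Lemma kernel_vanishing (y : R) v : 0 < y ->
  orbit_integral ip V a (fun x => K (x +i* y)) v -> v = 0.
Proof.
have [w wP] : {w : R -> H & forall t : R, 0 < t -> orbit_integral ip V a (fun x => K (x +i* t)) (w t)}.
  apply: (choice (P := fun t u => 0 < t -> orbit_integral ip V a (fun x => K (x +i* t)) u)) => t.
  have [t0|] := boolP (0 < t); last by exists 0.
  by have [u hu] := orbit_integral_exists hH hV a (Kdom t0); exists u.
have wN (t : R) : 0 < t -> hnorm (w t) <= M * expR (m' * t) * pi * hnorm a.
  by move=> t0; apply: (orbit_integral_norm hH hV (Kdom t0)); exact: wP.
have M0 : 0 <= M.
  have [_ _ /(_ 0)] := Kdom (@ltr01 R).
  rewrite /oneDsqr expr0n addr0 invr1 mulr1 => /(le_trans (cabs_ge0 _)).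
  by rewrite pmulr_lge0 // expR_gt0.
have growth (y0 y1 : R) : 0 < y0 -> y0 < y1 ->
    hnorm (w y0) ^+ 2 * expR (2 * m * (y1 - y0)) <= hnorm (w y1) ^+ 2.
  move=> y00 y01; have [h0 [N [h00 KT]]] := Ktaylor y00 y01.
  have N0 : 0 <= N.
    have [] := KT y0; first by rewrite lexx ltW.
    move=> [_ _ /(_ 0)]; rewrite /oneDsqr expr0n addr0 invr1 mulr1 => /(le_trans (cabs_ge0 _)) //.
  set A := N * pi * hnorm a.
  have A0 : 0 <= A by rewrite !mulr_ge0 ?pi_ge0 ?(hnorm_ge0 ip).
  pose W := M * (expR (`|m'| * y1)) * pi * hnorm a.
  have W0 : 0 <= W by rewrite !mulr_ge0 ?pi_ge0 ?(hnorm_ge0 ip) // ltW // expR_gt0.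
  have wW y2 : y0 <= y2 <= y1 -> hnorm (w y2) <= W.
    move=> /andP[a1 a2]; have y2p : 0 < y2 by exact: lt_le_trans a1.
    apply: le_trans (wN _ y2p) _; rewrite !ler_wpM2r ?pi_ge0 ?(hnorm_ge0 ip) //.
    rewrite ler_wpM2l // ler_expR; apply: le_trans (ler_norm _) _.
    by rewrite normrM (gtr0_norm y2p) ler_wpM2l.
  (* A step of length h gives [u + r] with [u = w + h i w1], [|u| <= W + h0 A] and [|r| <= A h^2],
     so [C h^2] bounds the cross term 2 <u, r>. The growth is in |u|^2, by [gen]. *)
  pose C := 2 * (W + h0 * A) * A.
  apply: (@exp_growth R (fun t => hnorm (w t) ^+ 2) y0 y1 m C (W ^+ 2) h0) => //.
  - by apply: mulr_ge0 => //; apply: mulr_ge0 => //; rewrite addr_ge0 // mulr_ge0 // ltW.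
  - move=> t ht; rewrite sqr_ge0 /= ler_sqr ?nnegrE ?(hnorm_ge0 ip) //; exact: wW.
  move=> t h ty0 /andP[hp hh0] thy1.
  have tin : y0 <= t <= y1 by rewrite ty0 (le_trans _ thy1) // lerDl ltW.
  have t0 : 0 < t by exact: lt_le_trans ty0.
  have th0 : 0 < t + h by exact: addr_gt0.
  have [K'dom KTt] := KT t tin.
  have [w1 w1P] := orbit_integral_exists hH hV a K'dom.
  have w1N := orbit_integral_norm hH hV K'dom w1P.
  (* [V s] moves the weight to [K (x - s + i t)], so the expansion of [K] at the real increment
     [- s] puts [w t] in the domain of the generator, with Q w = i w1. The same expansion at the
     imaginary increment [i h] gives [rest]. *)
  have dV : Defs.deriv0 ip V (w t) (- w1).
    move=> e e0.
    have A1 : 0 < A + 1 by rewrite ltr_wpDl.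
    exists (Num.min h0 (e / (A + 1))); first by rewrite lt_min h00 divr_gt0.
    move=> s s0; rewrite lt_min => /andP[sh se].
    have sdom := cdominated_shift s (Kdom t0).
    have r1 := orbit_integral_shift hH hV (Kdom t0) sdom (wP _ t0).
    have r2 := orbit_integralD hH hV (-1) sdom (Kdom t0) r1 (wP _ t0).
    have d2 := cdominatedD (-1) sdom (Kdom t0).
    have r3 := orbit_integralD hH hV (s%:C) d2 K'dom r2 w1P.
    have d3 := cdominatedD (s%:C) d2 K'dom.
    have d4 := cdominated_bound (N := N * s ^+ 2) d3.
    have : hnorm (V s (w t) + (-1) *: w t + s%:C *: w1) <= N * s ^+ 2 * pi * hnorm a.
      apply: (orbit_integral_norm hH hV (d4 _) r3) => x.
      have -> : (x - s) +i* t = x +i* t + (- s)%:C.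
        by apply/eqP; rewrite eq_complex /= addr0 !eqxx.
      have := KTt x ((- s)%:C); rewrite cabs_real normrN real_normK ?num_real //.
      move=> /(_ (ltW sh)); congr (cabs _ <= _).
      by rewrite rmorphN mulN1r mulNr opprK.
    have -> : s^-1%:C *: (V s (w t) - w t) - - w1 =
        s^-1%:C *: (V s (w t) + (-1) *: w t + s%:C *: w1).
      by rewrite opprK scaleN1r [in RHS]scalerDr scalerA -rmorphM mulVf // rmorph1 scale1r.
    move=> hn; rewrite (hnormZr hH) normfV.
    have sp : 0 < `|s| by rewrite normr_gt0.
    rewrite mulrC ltr_pdivrMr //; apply: le_lt_trans hn _.
    have -> : N * s ^+ 2 * pi * hnorm a = A * `|s| * `|s|.
      by rewrite -[s ^+ 2]real_normK ?num_real // /A; ring.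
    rewrite ltr_pM2r //.
    apply: le_lt_trans (_ : (A + 1) * `|s| < e).
      by rewrite ler_wpM2r // lerDl ler01.
    by rewrite mulrC -ltr_pdivlMr.
  have gen : m * hnorm (w t) ^+ 2 <= B ('i *: w1) (w t).
    have := hQ dV; congr (_ <= complex.Re (ip _ _)).
    by rewrite scalerN scaleNr opprK.
  have rest : hnorm (w (t + h) - (w t + h%:C *: ('i *: w1))) <= A * h ^+ 2.
    have r2 := orbit_integralD hH hV (-1) (Kdom th0) (Kdom t0) (wP _ th0) (wP _ t0).
    have d2 := cdominatedD (-1) (Kdom th0) (Kdom t0).
    have r3 := orbit_integralD hH hV (- (h%:C * 'i)) d2 K'dom r2 w1P.
    have d3 := cdominatedD (- (h%:C * 'i)) d2 K'dom.
    have d4 := cdominated_bound (N := N * h ^+ 2) d3.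
    have -> : w (t + h) - (w t + h%:C *: ('i *: w1)) =
        w (t + h) + (-1) *: w t + - (h%:C * 'i) *: w1.
      by rewrite opprD addrA scaleN1r scalerA scaleNr.
    have -> : A * h ^+ 2 = N * h ^+ 2 * pi * hnorm a by rewrite /A; ring.
    apply: (orbit_integral_norm hH hV (d4 _) r3) => x.
    have e1 : x +i* (t + h) = x +i* t + h%:C * 'i.
      by apply/eqP; rewrite eq_complex /= !mulr0 !mulr1 subr0 !addr0 !eqxx.
    have e2 : cabs (h%:C * 'i) = h.
      by rewrite cabsM cabs_real gtr0_norm // /cabs /= expr0n expr1n add0r sqrtr1 mulr1.
    have := KTt x (h%:C * 'i); rewrite e2 -e1 => /(_ hh0).
    by rewrite mulN1r mulNr.
  move: rest; set u := w t + _; set r := w (t + h) - u => rN.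
  have uN : hnorm u <= W + h0 * A.
    apply: le_trans (hnormD hH _ _) _; rewrite lerD ?wW //.
    rewrite (hnormZr hH) (hnormZ hH) gtr0_norm //.
    have -> : cabs 'i = 1 :> R by rewrite /cabs /= expr0n expr1n add0r sqrtr1.
    by rewrite mul1r; apply: ler_pM => //; [exact: ltW|exact: hnorm_ge0].
  have -> : w (t + h) = u + r by rewrite /r [RHS]addrC subrK.
  have sq x1 x2 : B (x1 + x2) (x1 + x2) = B x1 x1 + 2 * B x1 x2 + B x2 x2.
    by rewrite !(ripE hH) (ripC hH x2); ring.
  rewrite [leRHS](hnorm_sqr hH) sq.
  have uu : hnorm (w t) ^+ 2 * (1 + 2 * m * h) <= B u u.
    rewrite /u !(ripE hH) (ripC hH (w t)) -(hnorm_sqr hH (w t)) -(hnorm_sqr hH ('i *: w1)).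
    have := sqr_ge0 (h * hnorm ('i *: w1)); rewrite exprMn.
    have := ler_wpM2l (ltW hp) gen; lra.
  have ur : - (C / 2 * h ^+ 2) <= B u r.
    have : - (hnorm u * hnorm r) <= B u r by rewrite lerNl (le_trans _ (rip_CS hH u r)) // -normrN ler_norm.
    apply: le_trans; rewrite lerN2 /C.
    have -> : 2 * (W + h0 * A) * A / 2 * h ^+ 2 = (W + h0 * A) * (A * h ^+ 2) by field.
    by apply: ler_pM => //; exact: hnorm_ge0.
  have := rip_ge0 hH r; lra.
move=> y0 hv.
suff wy0 : hnorm (w y) ^+ 2 = 0.
  have -> : v = w y by exact: (orbit_integral_uniq hH hv (wP _ y0)).
  by apply: (hnorm_eq0 hH); apply/eqP; rewrite -sqrf_eq0 wy0.
apply/eqP; rewrite eq_le sqr_ge0 andbT.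
apply/ler_addgt0Pr => e e0; rewrite add0r.
pose D := (M * pi * hnorm a) ^+ 2 * expR (2 * m * y).
have D0 : 0 <= D by rewrite mulr_ge0 ?sqr_ge0 // ltW // expR_gt0.
pose c := 2 * (m - m').
have c0 : 0 < c by rewrite mulr_gt0 // subr_gt0.
(* At this height [c y1 >= D / e], hence [e^{c y1} >= D / e] and the surviving bound [D e^{- c y1}]
   is at most [e]. *)
pose y1 := y + 1 + D / e / c.
have yy1 : y < y1 by rewrite /y1 -addrA ltrDl ltr_pwDl // !divr_ge0 // ltW.
have y10 : 0 < y1 by exact: lt_trans yy1.
have := growth _ _ y0 yy1.
rewrite -ler_pdivlMr ?expR_gt0 // -expRN => /le_trans; apply.
have b1 : hnorm (w y1) ^+ 2 <= (M * expR (m' * y1) * pi * hnorm a) ^+ 2.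
  rewrite ler_sqr ?nnegrE ?(hnorm_ge0 ip) ?wN //.
  by apply: le_trans (wN _ y10); exact: hnorm_ge0.
apply: le_trans (ler_wpM2r (ltW (expR_gt0 _)) b1) _.
have -> : (M * expR (m' * y1) * pi * hnorm a) ^+ 2 * expR (- (2 * m * (y1 - y)))
     = D * expR (- (c * y1)).
  have -> : expR (- (c * y1)) = expR (m' * y1) ^+ 2 * expR (- (2 * m * y1)).
    by rewrite -expRM_natl -expRD; congr expR; rewrite /c; ring.
  have -> : expR (- (2 * m * (y1 - y))) = expR (2 * m * y) * expR (- (2 * m * y1)).
    by rewrite -expRD; congr expR; ring.
  by rewrite /D; ring.
rewrite expRN -[leLHS]/(D / _) ler_pdivrMr ?expR_gt0 // mulrC -ler_pdivrMr //.
apply: le_trans (expR_ge1Dx _).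
have -> : c * y1 = c * (y + 1) + D / e by rewrite /y1; field; rewrite ?gt_eqF.
by rewrite addrA lerDr addr_ge0 // mulr_ge0 ?addr_ge0 // ltW.
Qed.

End KernelVanishing.

(** * The kernel *)

Section ComplexExponential.
Variable R : realType.
Implicit Types (z w : R[i]) (p q : R).

Lemma cabs_le_ReIm z : cabs z <= `|complex.Re z| + `|complex.Im z|.
Proof.
apply: cabs_le; first by rewrite addr_ge0.
rewrite sqrrD !real_normK ?num_real //.
by have := mulr_ge0 (normr_ge0 (complex.Re z)) (normr_ge0 (complex.Im z)); lra.
Qed.

Lemma cos_sub1_le q : `|cos q - 1| <= `|q|.
Proof.
wlog q0 : q / 0 < q => [h|].
  have [q0|/h//|->] := ltgtP q 0; last by rewrite cos0 subrr normr0.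
  by rewrite -cosN -(normrN q); apply: h; rewrite oppr_gt0.
have dq x : x \in `]0, q[ -> is_derive x 1 cos (- sin x).
  by move=> _; exact: is_derive_cos.
have cq' : {within `[0, q], continuous cos}.
  by apply: continuous_subspaceT; exact: continuous_cos.
have [c] := MVT q0 dq cq'; rewrite in_itv /= => _.
rewrite cos0 subr0 => ->; rewrite normrM normrN.
by rewrite ler_piMl // sin_max.
Qed.

(** A quadratic error is all that [cexp_taylor] requires; the mean value theorem with the bound on
    cos - 1 gives it. *)
Lemma sin_sub_le q : `|sin q - q| <= q ^+ 2.
Proof.
wlog q0 : q / 0 < q => [h|].
  have [q0|/h//|->] := ltgtP q 0; last by rewrite sin0 subrr normr0 expr0n.
  by have := h (- q); rewrite oppr_gt0 sqrrN sinN -opprD normrN; apply.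
have dq x : x \in `]0, q[ -> is_derive x 1 ((fun x => sin x - x) : R -> R) (cos x - 1).
  by move=> _; apply: is_deriveB.
have cq' : {within `[0, q], continuous ((fun x => sin x - x) : R -> R)}.
  by apply: continuous_subspaceT => x; apply: continuousB; [exact: continuous_sin|exact: cvg_id].
have [c] := MVT q0 dq cq'; rewrite in_itv /= => /andP[c0 cq].
rewrite sin0 !subr0 => ->.
rewrite normrM [X in _ * X]gtr0_norm // expr2 ler_pM2r //.
by apply: le_trans (cos_sub1_le c) _; rewrite gtr0_norm // ltW.
Qed.

Lemma sin_le q : `|sin q| <= `|q|.
Proof.
wlog q0 : q / 0 < q => [h|].
  have [q0|/h//|->] := ltgtP q 0; last by rewrite sin0.
  by rewrite -normrN -sinN -(normrN q); apply: h; rewrite oppr_gt0.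
have dq x : x \in `]0, q[ -> is_derive x 1 sin (cos x).
  by move=> _; exact: is_derive_sin.
have cq' : {within `[0, q], continuous sin}.
  by apply: continuous_subspaceT; exact: continuous_sin.
have [c] := MVT q0 dq cq'; rewrite in_itv /= => _.
by rewrite sin0 !subr0 => ->; rewrite normrM ler_piMl // cos_max.
Qed.

Lemma cos_sub1_le_sqr q : `|cos q - 1| <= q ^+ 2.
Proof.
wlog q0 : q / 0 < q => [h|].
  have [q0|/h//|->] := ltgtP q 0; last by rewrite cos0 subrr normr0 expr0n.
  by rewrite -cosN -sqrrN; apply: h; rewrite oppr_gt0.
have dq x : x \in `]0, q[ -> is_derive x 1 cos (- sin x).
  by move=> _; exact: is_derive_cos.
have cq' : {within `[0, q], continuous cos}.
  by apply: continuous_subspaceT; exact: continuous_cos.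
have [c] := MVT q0 dq cq'; rewrite in_itv /= => /andP[c0 cq].
rewrite cos0 subr0 => ->.
rewrite normrM normrN [X in _ * X]gtr0_norm // expr2 ler_pM2r //.
by apply: le_trans (sin_le c) _; rewrite gtr0_norm // ltW.
Qed.

(** Convexity at [p] and [- p] traps the exponential between 1 + p and 1/(1 - p), and (1 + p +
    2p^2)(1 - p) = 1 + p^2 (1 - 2p) >= 1. *)
Lemma expR_sub_le p : `|p| <= 2^-1 -> `|expR p - 1 - p| <= 2 * p ^+ 2.
Proof.
rewrite ler_norml => /andP[p1 p2].
have h1 : 1 + p <= expR p := expR_ge1Dx p.
have h2 : 1 - p <= expR (- p) := expR_ge1Dx (- p).
rewrite ger0_norm; last by lra.
have e0 := expR_gt0 p.
have : expR p * (1 - p) <= 1.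
  by rewrite -[leRHS](expRxMexpNx_1 p) ler_pM2l.
move=> h3.
suff : (expR p - 1 - p - 2 * p ^+ 2) * (1 - p) <= 0.
  by rewrite pmulr_lle0; lra.
have : 0 <= p ^+ 2 * (1 - 2 * p) by rewrite mulr_ge0 ?sqr_ge0 //; lra.
nra.
Qed.

Definition cexp z : R[i] :=
  (expR (complex.Re z) * cos (complex.Im z)) +i* (expR (complex.Re z) * sin (complex.Im z)).

Lemma cexpD z w : cexp (z + w) = cexp z * cexp w.
Proof.
apply/eqP; rewrite eq_complex ReM ImM /= ReD ImD expRD cosD sinD.
by apply/andP; split; apply/eqP; ring.
Qed.

Lemma cabs_cexp z : cabs (cexp z) = expR (complex.Re z).
Proof.
by rewrite /cabs /= !exprMn -mulrDr cos2Dsin2 mulr1 sqrtr_sqr ger0_norm.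
Qed.

Lemma cexp_taylor z : cabs z <= 2^-1 -> cabs (cexp z - 1 - z) <= 10 * cabs z ^+ 2.
Proof.
move=> hz.
have hp := le_trans (ler_Re_cabs z) hz; have hq := le_trans (ler_Im_cabs z) hz.
rewrite cabs_sqr; move: hp hq; case: z {hz} => p q /=.
move=> hp hq; apply: le_trans (cabs_le_ReIm _) _; rewrite /cexp /=.
have e1 := expR_sub_le hp.
have c1 := cos_sub1_le_sqr q; have s1 := sin_sub_le q.
have E0 := expR_gt0 p.
have E2 : expR p <= 2.
  move: e1 hp; rewrite !ler_norml => /andP[_ a1] /andP[a2 a3].
  by have : p ^+ 2 <= 2^-1 * 2^-1; [nra|lra].
have a1 : `|expR p * cos q - 1 - p| <= 2 * p ^+ 2 + 2 * q ^+ 2.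
  have -> : expR p * cos q - 1 - p = (expR p - 1 - p) + expR p * (cos q - 1) by ring.
  apply: le_trans (ler_normD _ _) _; rewrite lerD // normrM gtr0_norm //.
  by apply: ler_pM => //; exact: ltW.
have a2 : `|expR p * sin q - 0 - q| <= 2 * q ^+ 2 + 2 * (`|p| * `|q|).
  have -> : expR p * sin q - 0 - q = expR p * (sin q - q) + (expR p - 1) * q by ring.
  apply: le_trans (ler_normD _ _) _; rewrite lerD //.
    by rewrite normrM gtr0_norm //; apply: ler_pM => //; exact: ltW.
  rewrite normrM mulrA ler_wpM2r //.
  have -> : expR p - 1 = (expR p - 1 - p) + p by ring.
  apply: le_trans (ler_normD _ _) _.
  have : p ^+ 2 <= 2^-1 * `|p| by rewrite -real_normK ?num_real // expr2 ler_wpM2r.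
  by lra.
have : 2 * (`|p| * `|q|) <= p ^+ 2 + q ^+ 2.
  rewrite -[p ^+ 2]real_normK ?num_real // -[q ^+ 2]real_normK ?num_real //.
  by have := sqr_ge0 (`|p| - `|q|); rewrite sqrrB; lra.
have := sqr_ge0 p; have := sqr_ge0 q; move: a1 a2; lra.
Qed.

End ComplexExponential.

Section SlitSquareRoot.
Variable R : realType.
Variable delta : R.
Hypothesis delta_gt0 : 0 < delta.
Implicit Types z : R[i].

(* The branch of sqrt (delta^2 - z^2) with nonnegative real part that is
   continuous on the closed upper half-plane: below the cut |x| >= delta the
   sign of the imaginary part is opposite to that of x. *)
Definition slit_sqrt z : R[i] :=
  let x := complex.Re z in let y := complex.Im z in
  let A := delta ^+ 2 - x ^+ 2 + y ^+ 2 in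
  let r := Num.sqrt (A ^+ 2 + (2 * x * y) ^+ 2) in
  Num.sqrt ((r + A) / 2) +i*
    (if 0 < x then - Num.sqrt ((r - A) / 2) else Num.sqrt ((r - A) / 2)).

Local Notation s := slit_sqrt.

Lemma slit_sqrt_Re_ge0 z : 0 <= complex.Re (s z).
Proof. exact: sqrtr_ge0. Qed.

Lemma slit_sqrt_sqr z : 0 <= complex.Im z -> s z ^+ 2 = (delta ^+ 2)%:C - z ^+ 2.
Proof.
case: z => x y /= y0; rewrite /slit_sqrt /=.
set A := delta ^+ 2 - x ^+ 2 + y ^+ 2; set r := Num.sqrt (A ^+ 2 + _).
have r0 : 0 <= r by exact: sqrtr_ge0.
have r2 : r ^+ 2 = A ^+ 2 + (2 * x * y) ^+ 2.
  by apply: sqr_sqrtr; apply: addr_ge0; exact: sqr_ge0.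
have Ar : `|A| <= r.
  by rewrite -ler_sqr ?nnegrE // real_normK ?num_real // r2 lerDl sqr_ge0.
move: Ar; rewrite ler_norml => /andP[Ar1 Ar2].
have p0 : 0 <= (r + A) / 2 by rewrite divr_ge0 //; lra.
have q0 : 0 <= (r - A) / 2 by rewrite divr_ge0 //; lra.
set P := Num.sqrt ((r + A) / 2); set Q := Num.sqrt ((r - A) / 2).
have P2 : P ^+ 2 = (r + A) / 2 by rewrite sqr_sqrtr.
have Q2 : Q ^+ 2 = (r - A) / 2 by rewrite sqr_sqrtr.
have PQ : P * Q = `|x| * y.
  apply/eqP; rewrite -(eqrXn2 (n := 2)) ?mulr_ge0 ?sqrtr_ge0 //.
  rewrite !exprMn P2 Q2 real_normK ?num_real //; apply/eqP.
  have -> : (r + A) / 2 * ((r - A) / 2) = (r ^+ 2 - A ^+ 2) / 4 by field.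
  by rewrite r2; field.
rewrite !expr2; apply/eqP; rewrite eq_complex /= -!expr2.
case: ifPn => [x0|]; last rewrite -leNgt => x0.
  move: PQ; rewrite gtr0_norm // => PQ.
  rewrite sqrrN P2 Q2; apply/andP; split; apply/eqP; first by rewrite /A; field.
  by move: PQ; lra.
move: PQ; rewrite ler0_norm // => PQ.
rewrite P2 Q2; apply/andP; split; apply/eqP; first by rewrite /A; field.
by move: PQ; lra.
Qed.

Lemma slit_sqrt_eqs z : 0 <= complex.Im z ->
  complex.Re (s z) ^+ 2 - complex.Im (s z) ^+ 2
     = delta ^+ 2 - complex.Re z ^+ 2 + complex.Im z ^+ 2 /\
  complex.Re (s z) * complex.Im (s z) = - (complex.Re z * complex.Im z).
Proof.
move=> /slit_sqrt_sqr; case: (s z) => p q; case: z => x y /=.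
by rewrite !expr2 => -[h1 h2]; split; lra.
Qed.

(** The upper bound limits the growth of e^{m's} to e^{m'(y + delta)}; the lower one keeps s away
    from 0 off the real axis. Eliminating the imaginary part leaves a quadratic equation for [p^2]
    ([h4]), which is compared with its values at [y^2] and [y^2 + delta^2]. *)
Lemma slit_sqrt_Re_bounds z : 0 <= complex.Im z ->
  complex.Im z <= complex.Re (s z) <= complex.Im z + delta.
Proof.
move=> y0; have [h1 h2] := slit_sqrt_eqs y0.
have := slit_sqrt_Re_ge0 z.
move: y0 h1 h2; move: (complex.Re (s z)) (complex.Im (s z)) (complex.Re z) (complex.Im z).
move=> p q x y y0 h1 h2 p0.
have h3 : p ^+ 2 * q ^+ 2 = x ^+ 2 * y ^+ 2 by rewrite -exprMn h2 sqrrN exprMn.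
have h4 : p ^+ 2 * p ^+ 2 = p ^+ 2 * (delta ^+ 2 - x ^+ 2 + y ^+ 2) + x ^+ 2 * y ^+ 2.
  by rewrite -h3 -h1; ring.
have x2 := sqr_ge0 x; have y2 := sqr_ge0 y; have p2 := sqr_ge0 p.
have d2 : 0 < delta ^+ 2 by rewrite exprn_gt0.
have sy : y ^+ 2 <= p ^+ 2.
  rewrite leNgt; apply/negP => lt.
  have : (y ^+ 2 - p ^+ 2) * (p ^+ 2 + x ^+ 2) + p ^+ 2 * delta ^+ 2 = 0.
    by move: h4; lra.
  have [p0'|p0'] := eqVneq (p ^+ 2) 0.
    rewrite p0' mul0r subr0 !add0r addr0 => /eqP; rewrite mulf_eq0 => /orP[/eqP e|/eqP e].
      by move: lt; rewrite e p0' ltxx.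
    have q2 := sqr_ge0 q.
    by move: h1; rewrite p0' e; lra.
  have pp : 0 < p ^+ 2 by rewrite lt_neqAle eq_sym p0' p2.
  have := mulr_gt0 pp d2.
  have : 0 <= (y ^+ 2 - p ^+ 2) * (p ^+ 2 + x ^+ 2) by apply: mulr_ge0; [rewrite subr_ge0 ltW|rewrite addr_ge0].
  by lra.
have sd : p ^+ 2 <= y ^+ 2 + delta ^+ 2.
  rewrite leNgt; apply/negP => lt.
  have : (p ^+ 2 - (y ^+ 2 + delta ^+ 2)) * (p ^+ 2 + x ^+ 2) + x ^+ 2 * delta ^+ 2 = 0.
    by move: h4; lra.
  have : 0 < (p ^+ 2 - (y ^+ 2 + delta ^+ 2)) * (p ^+ 2 + x ^+ 2).
    by rewrite mulr_gt0 ?subr_gt0 // ltr_pwDl //; lra.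
  have : 0 <= x ^+ 2 * delta ^+ 2 by rewrite mulr_ge0 // ltW.
  lra.
apply/andP; split; first by rewrite -ler_sqr ?nnegrE.
rewrite -ler_sqr ?nnegrE ?addr_ge0 // ?(ltW delta_gt0) // sqrrD.
have : 0 <= y * delta by rewrite mulr_ge0 // ltW.
by lra.
Qed.

Lemma slit_sqrt_inside (x : R) : `|x| <= delta ->
  s (x +i* 0) = (Num.sqrt (delta ^+ 2 - x ^+ 2))%:C.
Proof.
move=> xd; rewrite /slit_sqrt /= !mulr0 expr0n !addr0 sqrtr_sqr.
have d0 : 0 <= delta ^+ 2 - x ^+ 2.
  by rewrite subr_ge0 -[x ^+ 2]real_normK ?num_real // ler_sqr ?nnegrE // ltW.
rewrite ger0_norm // subrr mul0r sqrtr0 oppr0 if_same; congr (Num.sqrt _ +i* _).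
by field.
Qed.

Lemma slit_sqrt_outside (x : R) : delta <= `|x| ->
  complex.Re (s (x +i* 0)) = 0.
Proof.
move=> xd; rewrite /slit_sqrt /= !mulr0 expr0n !addr0 sqrtr_sqr.
have d0 : delta ^+ 2 - x ^+ 2 <= 0.
  by rewrite subr_le0 -[x ^+ 2]real_normK ?num_real // ler_sqr ?nnegrE // ltW.
by rewrite ler0_norm // addNr mul0r sqrtr0.
Qed.

End SlitSquareRoot.

Lemma cabs_nat (R : realType) n : cabs (n%:R : R[i]) = n%:R.
Proof.
have -> : n%:R = (n%:R)%:C :> R[i] by rewrite rmorph_nat.
by rewrite cabs_real ger0_norm.
Qed.

(** * First-order expansions, uniform on horizontal strips *)

Section StripTaylor.
Variable R : realType.
Implicit Types (phi psi u : R[i] -> R[i]) (g k : R -> R) (x y N M D : R) (h c : R[i]).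

(** Complex differentiability in the form usable under the integral: the weight [g] carries the
    decay in x, and complex [h] covers horizontal and vertical increments at once. *)
Definition taylor (y0 y1 : R) phi phi' g : Prop :=
  exists N h0 : R, [/\ 0 <= N, 0 < h0, h0 <= 1 &
    forall x y h, y0 <= y <= y1 -> cabs h <= h0 ->
    [/\ cabs (phi (x +i* y)) <= N * g x, cabs (phi' (x +i* y)) <= N * g x &
        cabs (phi (x +i* y + h) - phi (x +i* y) - h * phi' (x +i* y)) <= N * cabs h ^+ 2 * g x]].

(** No bound on [u] itself, because s and z are unbounded along a strip; only their derivatives are
    bounded. *)
Definition smooth (y0 y1 : R) u u' : Prop :=
  exists N h0 : R, [/\ 0 <= N, 0 < h0, h0 <= 1 &
    forall x y h, y0 <= y <= y1 -> cabs h <= h0 ->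
    cabs (u' (x +i* y)) <= N /\
    cabs (u (x +i* y + h) - u (x +i* y) - h * u' (x +i* y)) <= N * cabs h ^+ 2].

(** The remainder of a product splits into six terms, each at most [N * M * cabs h ^+ 2] times the
    weights; radii at most 1 absorb the higher powers of [h]. *)
Lemma taylorM (y0 y1 : R) phi phi' psi psi' g k :
  (forall x, 0 <= g x) -> (forall x, 0 <= k x) ->
  taylor y0 y1 phi phi' g -> taylor y0 y1 psi psi' k ->
  taylor y0 y1 (fun z => phi z * psi z) (fun z => phi' z * psi z + phi z * psi' z)
    (fun x => g x * k x).
Proof.
move=> g0 k0 [N [h0 [N0 h00 h01 P]]] [M [j0 [M0 j00 j01 Q]]].
exists (6 * (N * M)), (Num.min h0 j0); split.
- by rewrite !mulr_ge0.
- by rewrite lt_min h00.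
- by rewrite ge_min h01.
move=> x y h hy; rewrite le_min => /andP[hh hj].
have [P1 P2 P3] := P x y h hy hh; have [Q1 Q2 Q3] := Q x y h hy hj.
set z := x +i* y in P1 P2 P3 Q1 Q2 Q3 *.
have gk : 0 <= N * M * (g x * k x) by rewrite !mulr_ge0.
have mul a b A B : cabs a <= N * A * g x -> cabs b <= M * B * k x ->
    cabs (a * b) <= A * B * (N * M * (g x * k x)).
  move=> ha hb; rewrite cabsM.
  have -> : A * B * (N * M * (g x * k x)) = (N * A * g x) * (M * B * k x) by ring.
  by apply: ler_pM => //; exact: cabs_ge0.
have one X w : X <= N * w -> X <= N * 1 * w by rewrite mulr1.
have one' X w : X <= M * w -> X <= M * 1 * w by rewrite mulr1.
have hc : cabs h <= 1 := le_trans hh h01.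
have c0 := cabs_ge0 h.
have hP2 : cabs (h * phi' z) <= N * cabs h * g x.
  by rewrite cabsM -mulrA mulrCA ler_wpM2l.
have hQ2 : cabs (h * psi' z) <= M * cabs h * k x.
  by rewrite cabsM -mulrA mulrCA ler_wpM2l.
split.
- by apply: le_trans (mul _ _ _ _ (one _ _ P1) (one' _ _ Q1)) _; lra.
- apply: le_trans (cabsD _ _) _.
  by have := mul _ _ _ _ (one _ _ P2) (one' _ _ Q1); have := mul _ _ _ _ (one _ _ P1) (one' _ _ Q2); lra.
set r := phi (z + h) - phi z - h * phi' z in P3.
set q := psi (z + h) - psi z - h * psi' z in Q3.
have -> : phi (z + h) * psi (z + h) - phi z * psi z - h * (phi' z * psi z + phi z * psi' z)
  = phi z * q + (h * phi' z) * (h * psi' z) + (h * phi' z) * q + r * psi z + r * (h * psi' z) + r * q.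
  by rewrite /r /q; ring.
have e1 := mul _ _ _ _ (one _ _ P1) Q3.
have e2 := mul _ _ _ _ hP2 hQ2.
have e3 := mul _ _ _ _ hP2 Q3.
have e4 := mul _ _ _ _ P3 (one' _ _ Q1).
have e5 := mul _ _ _ _ P3 hQ2.
have e6 := mul _ _ _ _ P3 Q3.
have tri a b c e f X : cabs (a + b + c + e + f + X : R[i]) <=
    cabs a + cabs b + cabs c + cabs e + cabs f + cabs X.
  by do 5 (apply: le_trans (cabsD _ _) _; rewrite lerD2r).
apply: le_trans (tri _ _ _ _ _ _) _.
have c2 : 0 <= cabs h ^+ 2 by exact: sqr_ge0.
have c3 : cabs h * cabs h ^+ 2 <= cabs h ^+ 2 by rewrite ler_piMl.
have c4 : cabs h ^+ 2 * cabs h ^+ 2 <= cabs h ^+ 2.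
  by rewrite ler_piMl // expr_le1.
rewrite (_ : 6 * (N * M) * cabs h ^+ 2 * (g x * k x) = 6 * (cabs h ^+ 2 * (N * M * (g x * k x)))); last by ring.
have d3 := ler_wpM2r gk c3; have d4 := ler_wpM2r gk c4.
move: e1 e2 e3 e4 e5 e6 d3 d4.
rewrite -expr2 mul1r mulr1 [cabs h ^+ 2 * cabs h]mulrC.
lra.
Qed.

Lemma smoothZ (y0 y1 : R) c u u' : smooth y0 y1 u u' ->
  smooth y0 y1 (fun z => c * u z) (fun z => c * u' z).
Proof.
move=> [N [h0 [N0 h00 h01 P]]]; exists (cabs c * N), h0; split => //.
  by rewrite mulr_ge0 ?cabs_ge0.
move=> x y h hy hh; have [P1 P2] := P x y h hy hh.
rewrite cabsM ler_wpM2l ?cabs_ge0 //; split => //.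
rewrite [X in cabs X](_ : _ = c * (u (x +i* y + h) - u (x +i* y) - h * u' (x +i* y))); last by ring.
by rewrite cabsM -mulrA ler_wpM2l ?cabs_ge0.
Qed.

Lemma smooth_addc (y0 y1 : R) c u u' : smooth y0 y1 u u' ->
  smooth y0 y1 (fun z => u z + c) u'.
Proof.
move=> [N [h0 [N0 h00 h01 P]]]; exists N, h0; split => //.
move=> x y h hy hh; have [P1 P2] := P x y h hy hh; split => //.
by move: P2; congr (cabs _ <= _); ring.
Qed.

Lemma smooth_id (y0 y1 : R) : smooth y0 y1 id (fun=> 1).
Proof.
exists 1, 1; split => // x y h _ _; rewrite cabs_real normr1; split => //.
rewrite (_ : _ - _ = 0); last by ring.
by rewrite cabs_real normr0 mul1r sqr_ge0.
Qed.

Lemma smooth_increment N u u' z h : cabs h <= 1 -> 0 <= N ->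
  cabs (u' z : R[i]) <= N -> cabs (u (z + h) - u z - h * u' z) <= N * cabs h ^+ 2 ->
  cabs (u (z + h) - u z) <= 2 * N * cabs h.
Proof.
move=> h1 N0 P1 P2.
rewrite -[X in cabs X](subrK (h * u' z)).
apply: le_trans (cabsD _ _) _; rewrite cabsM.
have := ler_wpM2l (cabs_ge0 h) P1.
have : N * cabs h ^+ 2 <= N * cabs h by rewrite ler_wpM2l // expr2 ler_piMl ?cabs_ge0.
by lra.
Qed.

Lemma taylor_cexp (y0 y1 : R) u u' D : smooth y0 y1 u u' ->
  (forall x y, y0 <= y <= y1 -> complex.Re (u (x +i* y)) <= D) ->
  taylor y0 y1 (fun z => cexp (u z)) (fun z => cexp (u z) * u' z) (fun=> 1).
Proof.
move=> [N [h0 [N0 h00 h01 P]]] hD.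
set E := expR D; have E0 : 0 <= E by exact: expR_ge0.
have N4 : 0 < 4 * N + 1 by rewrite ltr_wpDl // mulr_ge0.
(* The increment of [u] is at most [2 N |h|]; the radius brings it below 1/2, as [cexp_taylor]
   demands, and 40 is 10 times the square of this 2. *)
exists (E * (1 + N + 40 * N ^+ 2)), (Num.min h0 (4 * N + 1)^-1); split.
- by rewrite mulr_ge0 // !addr_ge0 // mulr_ge0 // sqr_ge0.
- by rewrite lt_min h00 invr_gt0.
- by rewrite ge_min h01.
move=> x y h hy; rewrite le_min => /andP[hh hj].
have [P1 P2] := P x y h hy hh; set z := x +i* y in P1 P2 *.
have n2 := sqr_ge0 N.
have hE : cabs (cexp (u z)) <= E by rewrite cabs_cexp ler_expR hD.
have h1 : cabs h <= 1 := le_trans hh h01.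
have c0 := cabs_ge0 h; have c2 := sqr_ge0 (cabs h).
have inc := smooth_increment h1 N0 P1 P2.
set sg := u (z + h) - u z in inc.
have sg2 : cabs sg <= 2^-1.
  apply: le_trans inc _; move: hj; rewrite -[_^-1]mul1r ler_pdivlMr // => hj.
  by nra.
rewrite !mulr1; split.
- by apply: le_trans hE _; rewrite ler_peMr //; lra.
- rewrite cabsM; apply: (@le_trans _ _ (E * N)); first by apply: ler_pM => //; exact: cabs_ge0.
  by rewrite ler_wpM2l //; lra.
have -> : cexp (u (z + h)) - cexp (u z) - h * (cexp (u z) * u' z)
   = cexp (u z) * ((cexp sg - 1 - sg) + (sg - h * u' z)).
  have -> : u (z + h) = u z + sg by rewrite /sg [RHS]addrC subrK.
  by rewrite cexpD; ring.
rewrite cabsM -mulrA; apply: ler_pM; rewrite ?cabs_ge0 //.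
apply: le_trans (cabsD _ _) _.
have t1 := cexp_taylor sg2.
have t2 : cabs sg ^+ 2 <= 4 * N ^+ 2 * cabs h ^+ 2.
  have -> : 4 * N ^+ 2 * cabs h ^+ 2 = (2 * N * cabs h) ^+ 2 by ring.
  by rewrite ler_sqr ?nnegrE ?cabs_ge0 // !mulr_ge0.
by move: P2; rewrite -/sg; lra.
Qed.

(** The lower bound on [u] is assumed on the whole closed half-plane because [z + h] may leave the
    strip; the radius [y0] keeps it in the half-plane. One inverse provides the weight [k], and the
    others are bounded through [k <= 1]. *)
Lemma taylor_inv (y0 y1 : R) u u' k M : 0 < y0 -> 0 <= M ->
  (forall x, 0 <= k x <= 1) ->
  smooth y0 y1 u u' ->
  (forall x y, 0 <= y -> u (x +i* y) != 0 /\ (cabs (u (x +i* y)))^-1 <= M * k x) ->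
  taylor y0 y1 (fun z => (u z)^-1) (fun z => - u' z / u z ^+ 2) k.
Proof.
move=> y00 M0 hk [N [h0 [N0 h00 h01 P]]] hu.
exists (M + N * M ^+ 2 + 4 * N ^+ 2 * M ^+ 3), (Num.min h0 y0); split.
- by rewrite !addr_ge0 // !mulr_ge0 ?exprn_ge0 ?sqr_ge0.
- by rewrite lt_min h00.
- by rewrite ge_min h01.
move=> x y h hy; rewrite le_min => /andP[hh hj].
have [P1 P2] := P x y h hy hh.
have n2 := sqr_ge0 N; have m2 := sqr_ge0 M.
have m3 : 0 <= M ^+ 3 by rewrite exprn_ge0.
have h1 : cabs h <= 1 := le_trans hh h01.
have inc := smooth_increment h1 N0 P1 P2.
have [hy0 _] := andP hy.
have [u0 uM] := hu x y (le_trans (ltW y00) hy0).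
have [v0 vM] : u (x +i* y + h) != 0 /\ cabs (u (x +i* y + h))^-1 <= M.
  have -> : x +i* y + h = (x + complex.Re h) +i* (y + complex.Im h) by case: h {hh hj P2 h1 inc}.
  have [|v0 vM] := hu (x + complex.Re h) (y + complex.Im h).
    have := ler_Im_cabs h; rewrite ler_norml => /andP[a _].
    by move: hj hy0 a; lra.
  split => //; rewrite cabsV; apply: le_trans vM _.
  by rewrite ler_piMr //; case/andP: (hk (x + complex.Re h)).
set z := x +i* y in P1 P2 inc u0 uM v0 vM *.
have [k0 k1] := andP (hk x).
set U := (cabs (u z))^-1 in uM.
have U0 : 0 <= U by rewrite invr_ge0 cabs_ge0.
have k2 : k x ^+ 2 <= k x by rewrite expr2 ler_piMl.
have U2 : U ^+ 2 <= M ^+ 2 * k x.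
  apply: (@le_trans _ _ ((M * k x) ^+ 2)); first by rewrite ler_sqr ?nnegrE // mulr_ge0.
  by rewrite exprMn ler_wpM2l.
split.
- rewrite cabsV; apply: le_trans uM _; rewrite ler_wpM2r //.
  by have := mulr_ge0 N0 m2; have := mulr_ge0 n2 m3; lra.
- rewrite cabsM cabsN cabsV cabsX -exprVn.
  apply: le_trans (_ : N * (M ^+ 2 * k x) <= _); first by apply: ler_pM; rewrite ?cabs_ge0 ?sqr_ge0.
  by rewrite mulrA ler_wpM2r //; have := mulr_ge0 n2 m3; lra.
set sg := u (z + h) - u z in inc.
have -> : (u (z + h))^-1 - (u z)^-1 - h * (- u' z / u z ^+ 2) =
  - ((sg - h * u' z) * (u z)^-1 ^+ 2) + sg ^+ 2 * (u z)^-1 ^+ 2 * (u (z + h))^-1.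
  by rewrite /sg; field; rewrite u0 v0.
apply: le_trans (cabsD _ _) _; rewrite cabsN.
have -> : cabs ((sg - h * u' z) * (u z)^-1 ^+ 2) = cabs (sg - h * u' z) * U ^+ 2.
  by rewrite cabsM cabsX cabsV.
have -> : cabs (sg ^+ 2 * (u z)^-1 ^+ 2 * (u (z + h))^-1) =
    cabs sg ^+ 2 * U ^+ 2 * cabs (u (z + h))^-1.
  by rewrite cabsM [cabs (sg ^+ 2 * _)]cabsM !cabsX [cabs (u z)^-1]cabsV.
have t1 : cabs (sg - h * u' z) * U ^+ 2 <= N * cabs h ^+ 2 * (M ^+ 2 * k x).
  by apply: ler_pM; rewrite ?cabs_ge0 ?sqr_ge0.
have t2 : cabs sg ^+ 2 <= 4 * N ^+ 2 * cabs h ^+ 2.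
  have -> : 4 * N ^+ 2 * cabs h ^+ 2 = (2 * N * cabs h) ^+ 2 by ring.
  by rewrite ler_sqr ?nnegrE ?cabs_ge0 // !mulr_ge0 // cabs_ge0.
have t3 : cabs sg ^+ 2 * U ^+ 2 * cabs (u (z + h))^-1 <= 4 * N ^+ 2 * cabs h ^+ 2 * (M ^+ 2 * k x) * M.
  apply: ler_pM; [by apply: mulr_ge0; exact: sqr_ge0|exact: cabs_ge0| |exact: vM].
  by apply: ler_pM; rewrite ?sqr_ge0.
have t4 : 0 <= M * cabs h ^+ 2 * k x by rewrite !mulr_ge0 ?cabs_ge0.
apply: le_trans (lerD t1 t3) _.
by rewrite [leRHS](_ : _ = M * cabs h ^+ 2 * k x + (N * cabs h ^+ 2 * (M ^+ 2 * k x) +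
  4 * N ^+ 2 * cabs h ^+ 2 * (M ^+ 2 * k x) * M)); [rewrite lerDr|ring].
Qed.

End StripTaylor.

Section SlitSquareRootTaylor.
Variables (R : realType) (delta : R).
Hypothesis delta_gt0 : 0 < delta.
Local Notation s := (slit_sqrt delta).

(** Only the equation s^2 = delta^2 - z^2 is differentiated, never the explicit roots: (s1 + s2)(s2
    - s1) = -h(2z + h), and the remainder is -(h^2 + (s2 - s1)^2) / (2 s1). Nonnegative real parts
    exclude a jump to the other branch. *)
Lemma slit_sqrt_smooth (y0 y1 : R) : 0 < y0 ->
  smooth y0 y1 s (fun z => - z / s z).
Proof.
move=> y00.
(* Chosen so that [|z| <= L |s1|] and [|2z + h| <= P |s1|], using [|s1| >= y0] and [|h| <= 1]. *)
pose L := 1 + delta / y0; pose P := 2 * L + y0^-1.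
have d0 := ltW delta_gt0.
have L0 : 0 <= L by rewrite addr_ge0 // divr_ge0 // ltW.
have P0 : 0 < P by rewrite ltr_wpDl ?mulr_ge0 // invr_gt0.
pose h0 := Num.min 1 (Num.min y0 (y0 / (2 * P))).
have N0 : 0 <= (1 + P ^+ 2) / (2 * y0).
  by rewrite divr_ge0 ?addr_ge0 ?sqr_ge0 // mulr_ge0 // ltW.
exists (L + (1 + P ^+ 2) / (2 * y0)), h0; split.
- by rewrite addr_ge0.
- by rewrite !lt_min ltr01 y00 divr_gt0 // mulr_gt0.
- by rewrite ge_min lexx.
move=> x y h /andP[hy _]; rewrite !le_min => /and3P[h1 hy0 hP].
have y_ge0 : 0 <= y by exact: le_trans (ltW y00) hy.
set z := x +i* y; set s1 := s z; set s2 := s (z + h).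
have zh : 0 <= complex.Im (z + h).
  rewrite ImD /=; have := ler_Im_cabs h; rewrite ler_norml => /andP[a _].
  by move: hy0 hy a; lra.
have q1 : s1 ^+ 2 = (delta ^+ 2)%:C - z ^+ 2 by exact: slit_sqrt_sqr.
have q2 : s2 ^+ 2 = (delta ^+ 2)%:C - (z + h) ^+ 2 by exact: slit_sqrt_sqr.
have r1 : y0 <= complex.Re s1.
  by apply: le_trans hy _; have /andP[] := slit_sqrt_Re_bounds delta_gt0 (z := z) y_ge0.
have r2 : 0 <= complex.Re s2 by exact: slit_sqrt_Re_ge0.
have a1 : y0 <= cabs s1 := le_trans r1 (le_Re_cabs s1).
have a1p : 0 < cabs s1 by exact: lt_le_trans a1.
have a12 : y0 <= cabs (s1 + s2).
  by apply: le_trans (le_Re_cabs _); rewrite ReD; lra.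
have s1n : s1 != 0 by rewrite -cabs_gt0.
have zL : cabs z <= L * cabs s1.
  have : cabs z <= delta + cabs s1.
    have : cabs z ^+ 2 <= delta ^+ 2 + cabs s1 ^+ 2.
      rewrite -!cabsX (_ : z ^+ 2 = (delta ^+ 2)%:C - s1 ^+ 2); last by rewrite q1; ring.
      by apply: le_trans (cabsB _ _) _; rewrite cabs_real ger0_norm ?sqr_ge0.
    move=> hz; rewrite -ler_sqr ?nnegrE ?cabs_ge0 ?addr_ge0 ?cabs_ge0 // sqrrD.
    by have := mulr_ge0 d0 (cabs_ge0 s1); lra.
  move=> /le_trans; apply; rewrite /L mulrDl mul1r addrC lerD2l.
  by rewrite mulrAC ler_pdivlMr // ler_wpM2l.
set sg := s2 - s1.
have sgE : (s1 + s2) * sg = - (h * (2 * z + h)).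
  have -> : (s1 + s2) * sg = s2 ^+ 2 - s1 ^+ 2 by rewrite /sg; ring.
  by rewrite q1 q2; ring.
have hD : cabs (h * (2 * z + h)) <= cabs h * P * cabs s1.
  rewrite cabsM -mulrA ler_wpM2l ?cabs_ge0 //.
  apply: le_trans (cabsD _ _) _; rewrite cabsM.
  rewrite cabs_nat.
  have : 1 <= y0^-1 * cabs s1 by rewrite mulrC ler_pdivlMr // mul1r.
  by rewrite /P; lra.
have c0 := cabs_ge0 h.
have hP2 : cabs h * P <= y0 / 2.
  by move: hP; rewrite ler_pdivlMr ?mulr_gt0 //; lra.
have sgN : cabs sg <= P * cabs h.
  have eS : cabs (s1 + s2) * cabs sg <= cabs h * P * cabs s1.
    by rewrite -cabsM sgE cabsN.
  (* If [s1 + s2] were smaller than [s1], then [|sg| >= |s1|], and [eS] would give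
     [|s1 + s2| <= |h| P <= y0 / 2], against [a12]. *)
  have [le|lt] := leP (cabs s1) (cabs (s1 + s2)).
    rewrite -(ler_pM2r a1p); apply: le_trans (_ : cabs sg * cabs (s1 + s2) <= _).
      by rewrite ler_wpM2l ?cabs_ge0.
    by rewrite [leLHS]mulrC [P * cabs h]mulrC; exact: eS.
  have sg1 : cabs s1 <= cabs sg.
    have : cabs (s1 + s1) <= cabs (s1 + s2) + cabs sg.
      have -> : s1 + s1 = (s1 + s2) - sg by rewrite /sg; ring.
      exact: cabsB.
    have -> : s1 + s1 = 2 * s1 by ring.
    by rewrite cabsM cabs_nat; lra.
  have : cabs (s1 + s2) * cabs s1 <= cabs h * P * cabs s1.
    by apply: le_trans eS; rewrite ler_wpM2l ?cabs_ge0.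
  by rewrite ler_pM2r //; lra.
split.
  rewrite cabsM cabsN cabsV.
  by apply: (@le_trans _ _ L); [rewrite ler_pdivrMr|rewrite lerDl].
have -> : s2 - s1 - h * (- z / s1) = - ((h ^+ 2 + sg ^+ 2) / (2 * s1)).
  have e : 2 * s1 * sg = - (2 * z * h + h ^+ 2 + sg ^+ 2).
    have -> : 2 * s1 * sg = (s1 + s2) * sg - sg ^+ 2 by rewrite /sg; ring.
    by rewrite sgE; ring.
  have n2 : 2 != 0 :> R[i] by rewrite pnatr_eq0.
  have -> : s2 - s1 = (2 * s1 * sg) / (2 * s1) by rewrite /sg; field; rewrite s1n.
  by rewrite e; field; rewrite s1n.
rewrite cabsN cabsM cabsV.
have -> : cabs (2 * s1) = 2 * cabs s1 by rewrite cabsM cabs_nat.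
apply: (@le_trans _ _ (((1 + P ^+ 2) / (2 * y0)) * cabs h ^+ 2)); last first.
  by rewrite ler_wpM2r ?sqr_ge0 // lerDr.
rewrite mulrAC; apply: ler_pM; rewrite ?cabs_ge0 ?invr_ge0 ?mulr_ge0 ?cabs_ge0 //.
  apply: le_trans (cabsD _ _) _; rewrite !cabsX mulrDl mul1r lerD2l -exprMn.
  by rewrite ler_sqr ?nnegrE ?cabs_ge0 // mulr_ge0 // ltW.
by rewrite lef_pV2 ?posrE ?mulr_gt0 // ler_pM2l.
Qed.

End SlitSquareRootTaylor.

(** * Measurability and boundary limits of complex functions, by components *)

Section ComplexMeasurability.
Variable R : realType.
Implicit Types psi phi : R -> R[i].

Definition cmeasurable psi : Prop :=
  measurable_fun setT (fun x => complex.Re (psi x)) /\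
  measurable_fun setT (fun x => complex.Im (psi x)).

Lemma ReV (z : R[i]) : complex.Re z^-1 = complex.Re z / cabs z ^+ 2.
Proof. by rewrite cabs_sqr; case: z. Qed.

Lemma ImV (z : R[i]) : complex.Im z^-1 = - (complex.Im z / cabs z ^+ 2).
Proof. by rewrite cabs_sqr; case: z. Qed.

Lemma cmeasurable_cst c : cmeasurable (fun=> c).
Proof. by split; exact: measurable_cst. Qed.

Lemma cmeasurableD psi phi : cmeasurable psi -> cmeasurable phi ->
  cmeasurable (fun x => psi x + phi x).
Proof.
move=> [p1 p2] [q1 q2]; split.
  by under eq_fun do rewrite ReD; apply: measurable_funD.
by under eq_fun do rewrite ImD; apply: measurable_funD.
Qed.

Lemma cmeasurableN psi : cmeasurable psi -> cmeasurable (fun x => - psi x).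
Proof.
move=> [p1 p2]; split.
  by under eq_fun do rewrite ReN; exact: measurableT_comp.
by under eq_fun do rewrite ImN; exact: measurableT_comp.
Qed.

Lemma cmeasurableM psi phi : cmeasurable psi -> cmeasurable phi ->
  cmeasurable (fun x => psi x * phi x).
Proof.
move=> [p1 p2] [q1 q2]; split.
  by under eq_fun do rewrite ReM; apply: measurable_funB; exact: measurable_funM.
by under eq_fun do rewrite ImM; apply: measurable_funD; exact: measurable_funM.
Qed.

Lemma measurable_inv_pos (f : R -> R) : (forall x, 0 < f x) ->
  measurable_fun setT f -> measurable_fun setT (fun x => (f x)^-1).
Proof.
move=> f0 mf; rewrite (_ : (fun _ => _) = (fun x => expR (- ln (f x)))).
  apply: (measurableT_comp (@measurable_expR R)).
  exact: measurableT_comp (measurableT_comp (@measurable_ln R) mf).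
by apply/funext => x; rewrite expRN lnK // posrE.
Qed.

Lemma cmeasurableV psi : (forall x, psi x != 0) -> cmeasurable psi ->
  cmeasurable (fun x => (psi x)^-1).
Proof.
move=> p0 [p1 p2].
have mi : measurable_fun setT (fun x => (cabs (psi x) ^+ 2)^-1).
  apply: measurable_inv_pos; first by move=> x; rewrite exprn_gt0 // cabs_gt0.
  by under eq_fun do rewrite cabs_sqr; apply: measurable_funD; exact: measurable_funX.
split.
  by under eq_fun do rewrite ReV; exact: measurable_funM.
under eq_fun do rewrite ImV.
by apply: measurableT_comp => //; exact: measurable_funM.
Qed.

Lemma cmeasurable_cexp psi : cmeasurable psi -> cmeasurable (fun x => cexp (psi x)).
Proof.
move=> [p1 p2].
have mc : measurable_fun setT (@cos R) by apply: continuous_measurable_fun; exact: continuous_cos.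
have ms : measurable_fun setT (@sin R) by apply: continuous_measurable_fun; exact: continuous_sin.
have me := measurableT_comp (@measurable_expR R) p1.
split; apply: measurable_funM => //.
  exact: measurableT_comp mc p2.
exact: measurableT_comp ms p2.
Qed.

Lemma cmeasurable_line (y : R) : cmeasurable (fun x => x +i* y).
Proof. by split; [exact: measurable_id|exact: measurable_cst]. Qed.

Lemma cmeasurable_slit_sqrt (delta y : R) :
  cmeasurable (fun x => slit_sqrt delta (x +i* y)).
Proof.
have msq : measurable_fun setT (@Num.sqrt R).
  by apply: continuous_measurable_fun; exact: sqrt_continuous.
pose A x := delta ^+ 2 - x ^+ 2 + y ^+ 2 : R.
have mA : measurable_fun setT A.
  by apply: measurable_funD => //; apply: measurable_funB => //; exact: measurable_funX.
pose r x := Num.sqrt (A x ^+ 2 + (2 * x * y) ^+ 2) : R.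
have mr : measurable_fun setT r.
  apply: (measurableT_comp msq); apply: measurable_funD; first exact: measurable_funX.
  by apply: measurable_funX; apply: measurable_funM => //; apply: measurable_funM.
have mm : measurable_fun setT (fun x => Num.sqrt ((r x - A x) / 2)).
  by apply: (measurableT_comp msq); apply: measurable_funM => //; apply: measurable_funB.
split.
  by apply: (measurableT_comp msq); apply: measurable_funM => //; apply: measurable_funD.
apply: measurable_fun_ifT => //; first by apply: measurable_fun_ltr; [exact: measurable_cst|exact: measurable_id].
exact: measurableT_comp.
Qed.

End ComplexMeasurability.

Section ComplexLimits.
Variable R : realType.
Implicit Types (u v : nat -> R[i]) (k l : R[i]).

Definition ccvg u l : Prop :=
  (fun n => complex.Re (u n)) @ \oo --> complex.Re l /\
  (fun n => complex.Im (u n)) @ \oo --> complex.Im l.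

Lemma ccvg_cst l : ccvg (fun=> l) l.
Proof. by split; exact: cvg_cst. Qed.

Lemma ccvgD u v k l : ccvg u k -> ccvg v l -> ccvg (fun n => u n + v n) (k + l).
Proof.
move=> [u1 u2] [v1 v2]; split.
  by under eq_fun do rewrite ReD; rewrite ReD; exact: cvgD.
by under eq_fun do rewrite ImD; rewrite ImD; exact: cvgD.
Qed.

Lemma ccvgM u v k l : ccvg u k -> ccvg v l -> ccvg (fun n => u n * v n) (k * l).
Proof.
move=> [u1 u2] [v1 v2]; split.
  by under eq_fun do rewrite ReM; rewrite ReM; apply: cvgB; exact: cvgM.
by under eq_fun do rewrite ImM; rewrite ImM; apply: cvgD; exact: cvgM.
Qed.

Lemma ccvgV u l : l != 0 -> ccvg u l -> ccvg (fun n => (u n)^-1) l^-1.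
Proof.
move=> l0 [u1 u2].
have ci : (fun n => (cabs (u n) ^+ 2)^-1) @ \oo --> (cabs l ^+ 2)^-1.
  apply: cvgV; first by rewrite expf_neq0 // gt_eqF // cabs_gt0.
  under eq_fun do rewrite cabs_sqr; rewrite cabs_sqr.
  by apply: cvgD; rewrite expr2; under eq_fun do rewrite expr2; exact: cvgM.
split.
  by under eq_fun do rewrite ReV; rewrite ReV; exact: cvgM.
by under eq_fun do rewrite ImV; rewrite ImV; apply: cvgN; exact: cvgM.
Qed.

Lemma ccvg_cexp u l : ccvg u l -> ccvg (fun n => cexp (u n)) (cexp l).
Proof.
move=> [u1 u2].
split; apply: cvgM => //; apply: continuous_cvg => //.
- exact: continuous_expR.
- exact: continuous_cos.
- exact: continuous_expR.
- exact: continuous_sin.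
Qed.

Lemma ccvg_line (x : R) (y : nat -> R) : y @ \oo --> (0 : R) ->
  ccvg (fun n => x +i* y n) (x +i* 0).
Proof. by move=> h; split => //=; exact: cvg_cst. Qed.

Lemma ccvg_slit_sqrt (delta x : R) (y : nat -> R) : y @ \oo --> (0 : R) ->
  ccvg (fun n => slit_sqrt delta (x +i* y n)) (slit_sqrt delta (x +i* 0)).
Proof.
move=> h.
pose A (t : R) := delta ^+ 2 - x ^+ 2 + t ^+ 2.
have cX (f : nat -> R) (c : R) : f @ \oo --> c -> (fun n => f n ^+ 2) @ \oo --> c ^+ 2.
  by move=> fc; rewrite expr2; under eq_fun do rewrite expr2; exact: cvgM.
have cs (f : nat -> R) (c : R) : f @ \oo --> c -> (fun n => Num.sqrt (f n)) @ \oo --> Num.sqrt c.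
  by move=> fc; apply: continuous_cvg => //; exact: sqrt_continuous.
have cA : (fun n => A (y n)) @ \oo --> A 0 by apply: cvgD; [exact: cvg_cst|exact: cX].
pose r (t : R) := Num.sqrt (A t ^+ 2 + (2 * x * t) ^+ 2).
have cr : (fun n => r (y n)) @ \oo --> r 0.
  apply: cs; apply: cvgD; apply: cX => //.
  by apply: cvgM => //; exact: cvg_cst.
have cm : (fun n => Num.sqrt ((r (y n) - A (y n)) / 2)) @ \oo --> Num.sqrt ((r 0 - A 0) / 2).
  by apply: cs; apply: cvgM; [exact: cvgB|exact: cvg_cst].
split; first by apply: cs; apply: cvgM; [exact: cvgD|exact: cvg_cst].
by rewrite /slit_sqrt /=; case: ifP => _ //; exact: cvgN.
Qed.

End ComplexLimits.

(** * Domination and expansion of the concrete kernel *)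

Section SlitKernel.
Variable R : realType.
Variables delta kappa eta m' : R.
Hypotheses (delta_gt0 : 0 < delta) (kappa_gt0 : 0 < kappa) (eta_gt0 : 0 < eta) (m'_ge0 : 0 <= m').
Local Notation s := (slit_sqrt delta).

(** Each denominator grows like |x|, so together they give Cauchy domination down to the real axis,
    while the exponential costs at most e^{m'(y + delta)}. *)
Definition slit_kernel (z : R[i]) : R[i] :=
  cexp (m'%:C * s z) * (s z + kappa%:C)^-1 * (z + (0 +i* eta))^-1.

(** Left unsimplified, in exactly the shape that two uses of [taylorM] produce. *)
Definition slit_kernel' (z : R[i]) : R[i] :=
  (cexp (m'%:C * s z) * (m'%:C * (- z / s z)) * (s z + kappa%:C)^-1 +
   cexp (m'%:C * s z) * (- (- z / s z) / (s z + kappa%:C) ^+ 2)) * (z + (0 +i* eta))^-1 +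
  cexp (m'%:C * s z) * (s z + kappa%:C)^-1 * (- 1 / (z + (0 +i* eta)) ^+ 2).

(** The share of the decay that each of the two denominators supplies. *)
Definition cauchy_root (x : R) : R := Num.sqrt (oneDsqr x)^-1.

Lemma cauchy_root_bounds x : 0 <= cauchy_root x <= 1.
Proof.
by rewrite sqrtr_ge0 /= -[leRHS]sqrtr1 ler_wsqrtr // invf_le1 ?oneDsqr_gt0.
Qed.

Lemma cauchy_root_sqr x : cauchy_root x * cauchy_root x = (oneDsqr x)^-1.
Proof. by rewrite -expr2 sqr_sqrtr // oneDsqrV_ge0. Qed.

Lemma cauchy_root_bound (z : R[i]) (x M : R) : 1 <= M ->
  oneDsqr x <= M * cabs z ^+ 2 -> z != 0 /\ (cabs z)^-1 <= M * cauchy_root x.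
Proof.
move=> M1 h; have o := oneDsqr_gt0 x; have M0 : 0 < M by exact: lt_le_trans ltr01 M1.
have z2 : 0 < cabs z ^+ 2 by rewrite -(pmulr_rgt0 _ M0); exact: lt_le_trans o h.
have z0 : 0 < cabs z.
  by rewrite lt_neqAle cabs_ge0 andbT eq_sym; apply: contraTneq z2 => ->; rewrite expr0n ltxx.
split; first by rewrite -cabs_gt0.
have [r0 _] := andP (cauchy_root_bounds x).
rewrite -ler_sqr ?nnegrE ?invr_ge0 ?cabs_ge0 ?mulr_ge0 ?(ltW M0) //.
rewrite exprMn [cauchy_root x ^+ 2]expr2 cauchy_root_sqr exprVn.
rewrite -[leLHS]mul1r ler_pdivrMr // mulrAC ler_pdivlMr // mul1r.
by apply: le_trans h _; rewrite ler_wpM2r ?sqr_ge0 // expr2 ler_peMr ?(ltW M0).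
Qed.

(** Because Re s >= 0, |s + kappa|^2 >= |s|^2 + kappa^2, and |s|^2 >= x^2 - delta^2 by the equation
    for s^2. The constant compares this with 1 + x^2. *)
Lemma slit_sqrt_shift_bound x y : 0 <= y ->
  s (x +i* y) + kappa%:C != 0 /\
  (cabs (s (x +i* y) + kappa%:C))^-1 <= (1 + (1 + delta ^+ 2) / kappa ^+ 2) * cauchy_root x.
Proof.
move=> y0; have k2 : 0 < kappa ^+ 2 by rewrite exprn_gt0.
have d2 := sqr_ge0 delta.
apply: cauchy_root_bound; first by rewrite lerDl divr_ge0 ?addr_ge0 // ltW.
have := slit_sqrt_Re_ge0 delta (x +i* y).
have h : x ^+ 2 <= delta ^+ 2 + cabs (s (x +i* y)) ^+ 2.
  apply: (@le_trans _ _ (cabs (x +i* y) ^+ 2)); first by rewrite cabs_sqr /= lerDl sqr_ge0.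
  rewrite -!cabsX (slit_sqrt_sqr delta (z := x +i* y) y0).
  rewrite -{1}[(x +i* y) ^+ 2](subKr (delta ^+ 2)%:C).
  by apply: le_trans (cabsB _ _) _; rewrite cabs_real ger0_norm // lerD2l.
move: h; rewrite !cabs_sqr ReD ImD (Re_real kappa) (Im_real kappa) addr0.
move: (complex.Re (s _)) (complex.Im (s _)) => p q h p0.
have kp : 0 <= kappa * p by rewrite mulr_ge0 // ltW.
have pq : p ^+ 2 + q ^+ 2 + kappa ^+ 2 <= (p + kappa) ^+ 2 + q ^+ 2.
  by rewrite sqrrD; lra.
have e : (1 + delta ^+ 2) / kappa ^+ 2 * kappa ^+ 2 = 1 + delta ^+ 2 by rewrite divfK // gt_eqF.
apply: le_trans (_ : (1 + (1 + delta ^+ 2) / kappa ^+ 2) * (p ^+ 2 + q ^+ 2 + kappa ^+ 2) <= _); last first.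
  by rewrite ler_wpM2l // addr_ge0 // divr_ge0 ?addr_ge0 // ltW.
rewrite mulrDl mul1r mulrDr e /oneDsqr.
have : 0 <= (1 + delta ^+ 2) / kappa ^+ 2 * (p ^+ 2 + q ^+ 2).
  by rewrite mulr_ge0 ?divr_ge0 ?addr_ge0 ?sqr_ge0 // ltW.
lra.
Qed.

Lemma pole_shift_bound x y : 0 <= y ->
  (x +i* y) + (0 +i* eta) != 0 /\
  (cabs ((x +i* y) + (0 +i* eta)))^-1 <= (1 + (eta ^+ 2)^-1) * cauchy_root x.
Proof.
move=> y0; have e2 : 0 < eta ^+ 2 by rewrite exprn_gt0.
apply: cauchy_root_bound; first by rewrite lerDl invr_ge0 ltW.
rewrite cabs_sqr /= addr0.
have ye : eta ^+ 2 <= (y + eta) ^+ 2.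
  by rewrite ler_sqr ?nnegrE ?addr_ge0 // ?lerDr // ltW.
rewrite mulrDl mul1r mulrDr /oneDsqr.
have e : (eta ^+ 2)^-1 * eta ^+ 2 = 1 by rewrite mulVf // gt_eqF.
have := ler_wpM2l (_ : 0 <= (eta ^+ 2)^-1) ye; rewrite e => h.
have h' : 1 <= (eta ^+ 2)^-1 * (y + eta) ^+ 2 by apply: h; rewrite invr_ge0 ltW.
have : 0 <= (eta ^+ 2)^-1 * x ^+ 2 by rewrite mulr_ge0 ?sqr_ge0 // invr_ge0 ltW.
have := sqr_ge0 (y + eta); lra.
Qed.

Definition slit_kernel_bound : R :=
  (1 + (1 + delta ^+ 2) / kappa ^+ 2) * (1 + (eta ^+ 2)^-1) * expR (m' * delta).

Lemma slit_kernel_cmeasurable y : 0 <= y -> cmeasurable (fun x => slit_kernel (x +i* y)).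
Proof.
move=> y0.
have ms := cmeasurable_slit_sqrt delta y.
have mk := cmeasurableD ms (cmeasurable_cst kappa%:C).
have mz := cmeasurableD (cmeasurable_line y) (cmeasurable_cst (0 +i* eta)).
apply: cmeasurableM; first apply: cmeasurableM.
- apply: cmeasurable_cexp; apply: cmeasurableM => //; exact: cmeasurable_cst.
- by apply: cmeasurableV => // x; have [] := slit_sqrt_shift_bound x y0.
- by apply: cmeasurableV => // x; have [] := pole_shift_bound x y0.
Qed.

Lemma slit_kernel_le x y : 0 <= y ->
  cabs (slit_kernel (x +i* y)) <= slit_kernel_bound * expR (m' * y) * (oneDsqr x)^-1.
Proof.
move=> y0.
have [_ h1] := slit_sqrt_shift_bound x y0; have [_ h2] := pole_shift_bound x y0.
rewrite !cabsM !cabsV cabs_cexp -cauchy_root_sqr.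
have e : expR (complex.Re (m'%:C * s (x +i* y))) <= expR (m' * delta) * expR (m' * y).
  rewrite -expRD ler_expR ReM (Re_real m') (Im_real m') mul0r subr0 -mulrDr ler_wpM2l // addrC.
  by have /andP[_ h] := slit_sqrt_Re_bounds delta_gt0 (z := x +i* y) y0; exact: h.
rewrite /slit_kernel_bound.
rewrite [leRHS](_ : _ = expR (m' * delta) * expR (m' * y) *
  ((1 + (1 + delta ^+ 2) / kappa ^+ 2) * cauchy_root x) * ((1 + (eta ^+ 2)^-1) * cauchy_root x)); last by ring.
apply: ler_pM => //; rewrite ?invr_ge0 ?cabs_ge0 //.
  by rewrite mulr_ge0 ?expR_ge0 // invr_ge0 cabs_ge0.
by apply: ler_pM => //; rewrite ?expR_ge0 // invr_ge0 cabs_ge0.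
Qed.

Lemma slit_kernel_dominated y : 0 <= y ->
  cdominated (fun x => slit_kernel (x +i* y)) (slit_kernel_bound * expR (m' * y)).
Proof.
move=> y0; have [] := slit_kernel_cmeasurable y0; split => // x.
exact: slit_kernel_le.
Qed.

Lemma slit_kernel'_cmeasurable y : 0 < y -> cmeasurable (fun x => slit_kernel' (x +i* y)).
Proof.
move=> yp; have y0 := ltW yp.
have ms := cmeasurable_slit_sqrt delta y.
have mk := cmeasurableD ms (cmeasurable_cst kappa%:C).
have mz := cmeasurableD (cmeasurable_line y) (cmeasurable_cst (0 +i* eta)).
have k0 x : s (x +i* y) + kappa%:C != 0 by have [] := slit_sqrt_shift_bound x y0.
have z0 x : (x +i* y) + (0 +i* eta) != 0 by have [] := pole_shift_bound x y0.
have s0 x : s (x +i* y) != 0.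
  rewrite -cabs_gt0; apply: lt_le_trans (le_Re_cabs _).
  apply: lt_le_trans yp _.
  by have /andP[h _] := slit_sqrt_Re_bounds delta_gt0 (z := x +i* y) y0; exact: h.
have me : cmeasurable (fun x => cexp (m'%:C * s (x +i* y))).
  by apply: cmeasurable_cexp; apply: cmeasurableM => //; exact: cmeasurable_cst.
have md : cmeasurable (fun x => - (x +i* y) / s (x +i* y)).
  apply: cmeasurableM; last exact: cmeasurableV.
  by apply: cmeasurableN; exact: cmeasurable_line.
have mkV := cmeasurableV k0 mk; have mzV := cmeasurableV z0 mz.
have mkV2 : cmeasurable (fun x => ((s (x +i* y) + kappa%:C) ^+ 2)^-1).
  by under eq_fun do rewrite expr2 invfM; exact: cmeasurableM.
have mzV2 : cmeasurable (fun x => (((x +i* y) + (0 +i* eta)) ^+ 2)^-1).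
  by under eq_fun do rewrite expr2 invfM; exact: cmeasurableM.
rewrite /slit_kernel'.
apply: cmeasurableD; apply: cmeasurableM => //.
- apply: cmeasurableD; apply: cmeasurableM => //.
    by apply: cmeasurableM => //; apply: cmeasurableM => //; exact: cmeasurable_cst.
  by apply: cmeasurableM => //; exact: cmeasurableN.
- by apply: cmeasurableM.
- by apply: cmeasurableM => //; exact: cmeasurable_cst.
Qed.

Lemma slit_kernel_taylor (y0 y1 : R) : 0 < y0 ->
  taylor y0 y1 slit_kernel slit_kernel' (fun x => (oneDsqr x)^-1).
Proof.
move=> y00.
have ss := slit_sqrt_smooth delta_gt0 y1 y00.
have tA := taylor_cexp (D := m' * (y1 + delta)) (smoothZ m'%:C ss).
have d2 := sqr_ge0 delta.
have tB := taylor_inv y00 (_ : 0 <= 1 + (1 + delta ^+ 2) / kappa ^+ 2) cauchy_root_bounds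
  (smooth_addc kappa%:C ss) slit_sqrt_shift_bound.
have tC := taylor_inv y00 (_ : 0 <= 1 + (eta ^+ 2)^-1) cauchy_root_bounds
  (smooth_addc (0 +i* eta) (smooth_id y0 y1)) pole_shift_bound.
have r0 x : 0 <= cauchy_root x by case/andP: (cauchy_root_bounds x).
have := taylorM _ _ (taylorM _ _ (tA _) (tB _)) (tC _).
rewrite (_ : (fun x => 1 * cauchy_root x * cauchy_root x) = (fun x => (oneDsqr x)^-1)); last first.
  by apply/funext => x; rewrite mul1r cauchy_root_sqr.
apply => //.
- by move=> x; rewrite mul1r.
- move=> x y /andP[hy1 hy2]; rewrite ReM (Re_real m') (Im_real m') mul0r subr0 ler_wpM2l //.
  have /andP[_ h] := slit_sqrt_Re_bounds delta_gt0 (z := x +i* y) (le_trans (ltW y00) hy1).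
  by apply: le_trans h _; rewrite lerD2r.
- by rewrite addr_ge0 // divr_ge0 ?addr_ge0 ?sqr_ge0.
- by rewrite addr_ge0 // invr_ge0 sqr_ge0.
Qed.

End SlitKernel.

(** * The boundary estimate *)

Section RealIntegrals.
Variable R : realType.
Local Notation mu := (@lebesgue_measure R).

Lemma Rintegral_fold (g : R -> R) :
  mu.-integrable setT (EFin \o g) ->
  mu.-integrable setT (EFin \o (fun x => g (- x))) ->
  \int[mu]_x g x = \int[mu]_(x in `[0, +oo[) (g x + g (- x)).
Proof.
move=> ig ign.
have igS (A : set R) : measurable A -> mu.-integrable A (EFin \o g).
  by move=> mA; apply: integrableS ig.
have ignS (A : set R) : measurable A -> mu.-integrable A (EFin \o (fun x => g (- x))).
  by move=> mA; apply: integrableS ign.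
have -> : setT = [set` `]-oo, 0[%R] `|` [set` `[0, +oo[%R] :> set R.
  by rewrite -[LHS](setvU [set` `[(0 : R), +oo[%R]) setCitvr.
rewrite Rintegral_setU //; last 2 first.
- by apply: igS; apply: measurableU.
- rewrite disj_set2E; apply/eqP; rewrite -subset0 => x [] /=.
  by rewrite !in_itv /= andbT ltNge => /negP.
rewrite RintegralD //; [|exact: igS|exact: ignS].
rewrite addrC; congr (_ + _).
rewrite -[RHS]Rintegral_itv_obnd_cbnd; last by apply: ignS.
rewrite /Rintegral; congr fine.
have mN : measurable_fun setT (-%R : measurableTypeR R -> measurableTypeR R).
  exact: oppr_measurable.
have e : [set` `]0, +oo[%R] = (-%R : measurableTypeR R -> measurableTypeR R) @^-1` [set` `]-oo, 0[%R].
  by apply/seteqP; split => x /=; rewrite !in_itv /= ?andbT oppr_lt0.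
rewrite e.
have := @integral_pushforward _ _ _ _ R _ mN mu [set` `]-oo, 0[%R] (EFin \o g).
move=> /(_ _ _ _) <- //.
- by apply: eq_measure_integral => A mA _; apply/esym/lebesgue_measureN.
- by apply/measurable_EFinP; case/integrableP: ig => /measurable_EFinP.
- by rewrite -e; apply: ignS.
Qed.

Lemma is_derive_mull (c x df : R) (f : R -> R) :
  is_derive x 1 f df -> is_derive x 1 (fun t => c * f t) (c * df).
Proof. by move=> h; exact: (is_deriveZ c). Qed.

Lemma Rintegral_poisson (delta eta : R) : 0 < delta -> 0 < eta ->
  mu.-integrable `[0, delta] (EFin \o (fun x : R => eta / (x ^+ 2 + eta ^+ 2))) /\
  \int[mu]_(x in `[0, delta]) (eta / (x ^+ 2 + eta ^+ 2)) = atan (delta / eta).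
Proof.
move=> d0 e0.
have den x : 0 < x ^+ 2 + eta ^+ 2 by rewrite ltr_wpDl ?sqr_ge0 // exprn_gt0.
have c : continuous (fun x : R => eta / (x ^+ 2 + eta ^+ 2)).
  move=> x; apply: cvgM; first exact: cvg_cst.
  apply: cvgV; first by rewrite gt_eqF.
  by apply: cvgD; [exact: exprn_continuous|exact: cvg_cst].
pose F x := atan (eta^-1 * x).
have dF (x : R) : is_derive x 1 F (eta / (x ^+ 2 + eta ^+ 2)).
  have h : is_derive x 1 (fun x : R => eta^-1 * x) eta^-1.
    by rewrite -[X in is_derive _ _ _ X]mulr1; exact: is_derive_mull.
  have := @is_derive1_comp R atan (fun x : R => eta^-1 * x) x _ _ (is_derive1_atan _) h.
  move=> /is_derive_eq; apply.
  by field; rewrite gt_eqF //= gt_eqF // addrC.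
have cF : continuous F.
  move=> x; apply: differentiable_continuous; apply/derivable1_diffP.
  by have := dF x; case.
split.
  apply: continuous_compact_integrable; first exact: segment_compact.
  exact: continuous_subspaceT.
rewrite /Rintegral (@continuous_FTC2 _ _ F) //.
- by rewrite /F mulr0 atan0 sube0 mulrC.
- exact: continuous_subspaceT.
- split.
  + by move=> x _; have := dF x; case.
  + by apply: cvg_at_right_filter; exact: cF.
  + by apply: cvg_at_left_filter; exact: cF.
- by move=> x _; rewrite derive1E; have := dF x; case.
Qed.

(* The primitive is atan (sqrt (x^2 - d^2) / d) / d, of limit pi / (2 d). *)
Lemma integral_slit (d delta : R) : 0 < d -> d < delta ->
  (\int[mu]_(x in `[delta, +oo[) (x^-1 * (Num.sqrt (x ^+ 2 - d ^+ 2))^-1)%:E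
     <= (pi / (2 * d))%:E)%E.
Proof.
move=> d0 dd.
have del0 : 0 < delta by exact: lt_trans dd.
have pos x : delta <= x -> 0 < x ^+ 2 - d ^+ 2.
  move=> h; rewrite subr_gt0 ltr_sqr ?nnegrE ?(ltW d0) //; first exact: lt_le_trans h.
  by apply: ltW; exact: lt_le_trans h.
pose F x := d^-1 * atan (d^-1 * Num.sqrt (x ^+ 2 - d ^+ 2)).
have dF (x : R) : delta <= x -> is_derive x 1 F (x^-1 * (Num.sqrt (x ^+ 2 - d ^+ 2))^-1).
  move=> hx; have px := pos x hx.
  have x0 : 0 < x by exact: lt_le_trans hx.
  have s0 : 0 < Num.sqrt (x ^+ 2 - d ^+ 2) by rewrite sqrtr_gt0.
  have h1 : is_derive x 1 (fun x : R => x ^+ 2 - d ^+ 2) (2 * x).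
    by apply: is_derive_eq; rewrite subr0 /GRing.scale /=; ring.
  have h2 := @is_derive1_comp R Num.sqrt _ x _ _ (is_derive1_sqrt px) h1.
  have h3 : is_derive x 1 (fun x : R => d^-1 * Num.sqrt (x ^+ 2 - d ^+ 2))
     (d^-1 * ((2 * Num.sqrt (x ^+ 2 - d ^+ 2))^-1 * (2 * x))).
    exact: is_derive_mull.
  have h4 := @is_derive1_comp R atan _ x _ _ (is_derive1_atan _) h3.
  have h5 : is_derive x 1 F (d^-1 * ((1 + (d^-1 * Num.sqrt (x ^+ 2 - d ^+ 2)) ^+ 2)^-1 *
     (d^-1 * ((2 * Num.sqrt (x ^+ 2 - d ^+ 2))^-1 * (2 * x))))).
    exact: is_derive_mull.
  apply: (is_derive_eq h5).
  rewrite exprMn sqr_sqrtr ?ltW //.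
  have -> : 1 + d^-1 ^+ 2 * (x ^+ 2 - d ^+ 2) = x ^+ 2 / d ^+ 2 by field; rewrite gt_eqF.
  by field; rewrite !gt_eqF.
have cont x : delta <= x -> {for x, continuous F}.
  move=> h; apply: differentiable_continuous; apply/derivable1_diffP.
  by have := dF x h; case.
rewrite (@ge0_continuous_FTC2y _ _ F _ (d^-1 * (pi / 2))).
- rewrite -EFinB lee_fin.
  have -> : pi / (2 * d) = d^-1 * (pi / 2) by field; rewrite gt_eqF.
  rewrite lerBlDr lerDl mulr_ge0 ?invr_ge0 ?(ltW d0) //.
  by rewrite -[leLHS]atan0; apply: le_atan; rewrite mulr_ge0 ?invr_ge0 ?(ltW d0).
- by move=> x h; rewrite mulr_ge0 ?invr_ge0 // ltW //; exact: lt_le_trans h.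
- have cg x : delta <= x -> {for x, continuous (fun x : R => x^-1 * (Num.sqrt (x ^+ 2 - d ^+ 2))^-1)}.
    move=> h; have x0 : 0 < x by exact: lt_le_trans h.
    apply: cvgM; first by apply: cvgV; [rewrite gt_eqF|exact: cvg_id].
    apply: cvgV; first by rewrite gt_eqF // sqrtr_gt0 pos.
    apply: continuous_cvg; first exact: sqrt_continuous.
    by apply: cvgB; [exact: exprn_continuous|exact: cvg_cst].
  apply/continuous_within_itvcyP; split.
    by move=> x; rewrite in_itv /= andbT => h; apply: cg; exact: ltW.
  by apply: cvg_at_right_filter; exact: (cg _ (lexx _)).
- apply: cvgM; first exact: cvg_cst.
  have : (fun x : R => d^-1 * Num.sqrt (x ^+ 2 - d ^+ 2)) x @[x --> +oo] --> +oo.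
    apply/cvgryPge => A.
    pose A' := Num.max 0 A.
    exists (d * A' + d); split; first exact: num_real.
    move=> x hx; have A0 : 0 <= A' by rewrite le_max lexx.
    apply: (@le_trans _ _ A'); first by rewrite le_max lexx orbT.
    rewrite mulrC ler_pdivlMr // mulrC.
    have hA : 0 <= d * A' by rewrite mulr_ge0 // ltW.
    have -> : d * A' = Num.sqrt ((d * A') ^+ 2) by rewrite sqrtr_sqr ger0_norm.
    rewrite ler_wsqrtr // lerBrDr.
    have : (d * A' + d) ^+ 2 <= x ^+ 2 by rewrite ler_sqr ?nnegrE ?addr_ge0 ?(ltW d0) // ltW // (le_lt_trans _ hx) // addr_ge0 // ltW.
    rewrite sqrrD; have : 0 <= d * A' * d by rewrite mulr_ge0 // ltW.
    lra.
  by move=> h; apply: (cvg_comp _ _ h); exact: cvgy_atan.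
- by move=> x h; have := dF x (ltW h); case.
- by apply: cvg_at_right_filter; exact: (cont _ (lexx _)).
- move=> x; rewrite in_itv /= andbT => h; rewrite derive1E.
  by have := dF x (ltW h); case.
Qed.

End RealIntegrals.

(** * Passage to the real axis *)

Section SpectralGapDecay.
Variables (R : realType) (H : lmodType R[i]) (ip : H -> H -> R[i]).
Hypothesis hH : is_hilbert ip.
Local Notation hnorm := (hnorm ip).
Local Notation B := (rip ip).
Local Notation mu := (@lebesgue_measure R).
Variable V : R -> H -> H.
Hypothesis hV : unitary_group ip V.
Variable m : R.
Hypotheses (m_gt0 : 0 < m) (hQ : generator_ge ip V m).
Variable delta : R.
Hypothesis delta_gt0 : 0 < delta.

(** The integrals vanish at every height 1/(n+1), and dominated convergence carries this to height
    0, where growth of the averages gives no direct information. *)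
Lemma boundary_integral (kappa eta m' : R) a b : 0 < kappa -> 0 < eta -> 0 <= m' -> m' < m ->
  \int[mu]_x B (slit_kernel delta kappa eta m' (x +i* 0) *: V x a) b = 0.
Proof.
move=> k0 e0 m'0 m'm.
set K := slit_kernel delta kappa eta m'.
have Kdom (y : R) : 0 <= y -> cdominated (fun x => K (x +i* y)) (slit_kernel_bound delta kappa eta m' * expR (m' * y)).
  by move=> y0; exact: slit_kernel_dominated.
pose y (n : nat) : R := n.+1%:R^-1.
have y_gt0 n : 0 < y n by rewrite invr_gt0.
have zero n : \int[mu]_x B (K (x +i* y n) *: V x a) b = 0.
  have [v hv] := orbit_integral_exists hH hV a (Kdom _ (ltW (y_gt0 n))).
  rewrite -hv (_ : v = 0) ?(rip0l hH) //.
  apply: (@kernel_vanishing R H ip hH V hV m m_gt0 hQ K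
    (slit_kernel' delta kappa eta m') m' (slit_kernel_bound delta kappa eta m') m'm _ _ a (y n) v (y_gt0 n) hv).
    by move=> t t0; apply: Kdom; exact: ltW.
  move=> y0 y1 y00 y01.
  have [N [h0 [N0 h00 h01 T]]] := slit_kernel_taylor delta_gt0 k0 e0 m'0 y1 y00.
  exists h0, N; split => // t ht; split.
    have [mr mi] := slit_kernel'_cmeasurable m' delta_gt0 k0 e0 (lt_le_trans y00 (proj1 (andP ht))).
    split => // x; have [|_ h _] := T x t 0 ht; last exact: h.
    by rewrite cabs_real normr0 ltW.
  by move=> x h hh; have [] := T x t h ht hh.
have K0 := Kdom 0 (lexx 0).
(* Heights are at most 1, so [expR m'] replaces the height-dependent factor and the majorant is
   uniform in n. *)
pose C := slit_kernel_bound delta kappa eta m' * expR m'.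
have C0 : 0 <= slit_kernel_bound delta kappa eta m'.
  have [_ _ /(_ 0)] := K0; rewrite mulr0 expR0 mulr1 /oneDsqr expr0n addr0 invr1 mulr1.
  exact: le_trans (cabs_ge0 _).
have yC n : cdominated (fun x => K (x +i* y n)) C.
  apply: (cdominated_bound (Kdom _ (ltW (y_gt0 n)))) => x.
  have [_ _ h] := Kdom _ (ltW (y_gt0 n)); apply: le_trans (h x) _.
  rewrite ler_wpM2r ?oneDsqrV_ge0 // ler_wpM2l // ler_expR ler_piMr //.
  by rewrite invf_le1 // ler1n.
have ycvg : y @ \oo --> (0 : R) by exact: cvg_harmonic.
have lim x : (fun n => B (K (x +i* y n) *: V x a) b) @ \oo --> B (K (x +i* 0) *: V x a) b.
  have [c1 c2] : ccvg (fun n => K (x +i* y n)) (K (x +i* 0)).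
    apply: ccvgM; first apply: ccvgM.
    - by apply: ccvg_cexp; apply: ccvgM; [exact: ccvg_cst|exact: ccvg_slit_sqrt].
    - apply: ccvgV; first by have [] := slit_sqrt_shift_bound delta k0 x (lexx 0).
      by apply: ccvgD; [exact: ccvg_slit_sqrt|exact: ccvg_cst].
    - apply: ccvgV; first by have [] := pole_shift_bound e0 x (lexx 0).
      by apply: ccvgD; [exact: ccvg_line|exact: ccvg_cst].
  rewrite (scale_ReIm (K (x +i* 0))) !(ripE hH).
  under eq_fun do rewrite (scale_ReIm (K _)) !(ripE hH).
  by apply: cvgD; apply: cvgM => //; exact: cvg_cst.
pose M := C * hnorm a * hnorm b.
have M0 : 0 <= M.
  apply: mulr_ge0; last exact: hnorm_ge0.
  apply: mulr_ge0; last exact: hnorm_ge0.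
  by apply: mulr_ge0 => //; exact: expR_ge0.
have := @dominated_cvg _ _ _ mu setT measurableT
  (fun n x => (B (K (x +i* y n) *: V x a) b)%:E) (fun x => (B (K (x +i* 0) *: V x a) b)%:E)
  (fun x => (M * (oneDsqr x)^-1)%:E).
have -> : (fun n => \int[mu]_x (B (K (x +i* y n) *: V x a) b)%:E)%E = (fun=> 0%E).
  apply/funext => n; have := zero n; rewrite /Rintegral.
  move=> h; rewrite -[LHS]fineK ?h //.
  apply: integrable_fin_num => //; apply: cauchy_dominated_integrable.
  exact: orbit_integrand_dominated (yC n).
move=> D; rewrite /Rintegral.
suff D1 : (fun=> 0%E : \bar R) n @[n --> \oo] --> (\int[mu]_x (B (K (x +i* 0) *: V x a) b)%:E)%E.
  by rewrite -(cvg_lim (@ereal_hausdorff R) D1) (@lim_cst _ (@ereal_hausdorff R)).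
apply: D.
- by move=> n; apply/measurable_EFinP; exact: orbit_integrand_measurable (yC n).
- by move=> x _; apply: cvg_EFin; [exact: nearW|exact: lim].
- by move=> x _.
- apply: cauchy_dominated_integrable; split.
    by apply: measurable_funM; [exact: measurable_cst|exact: measurable_cauchy_density].
  by exists M => x; rewrite normrM !ger0_norm ?oneDsqrV_ge0.
- move=> n x _; rewrite /= lee_fin.
  exact: (orbit_integrand_le hH hV a b (yC n) x).
Qed.

End SpectralGapDecay.

(** Squaring and cancelling delta + k turns the hypothesis into delta (X^2 - C^2) <= k (X^2 + C^2),
    with k arbitrarily small. *)
Lemma ratio_limit (R : realType) (X C delta : R) : 0 < delta -> 0 <= C -> 0 < X ->
  (forall k, 0 < k -> k < delta -> X / (delta + k) <= C / Num.sqrt (delta ^+ 2 - k ^+ 2)) ->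
  X <= C.
Proof.
move=> delta_gt0 C0 X0 hX.
rewrite -ler_sqr ?nnegrE ?(ltW X0) //.
apply/ler_addgt0Pr => e e0.
pose k := Num.min (delta / 2) (e * delta / (X ^+ 2 + C ^+ 2)).
have xc : 0 < X ^+ 2 + C ^+ 2 by rewrite ltr_pwDl ?exprn_gt0 // sqr_ge0.
have k0 : 0 < k by rewrite lt_min !divr_gt0 // mulr_gt0.
have kd : k < delta.
  by apply: le_lt_trans (_ : delta / 2 < _); rewrite ?ge_min ?lexx //; have := delta_gt0; lra.
have ke : k * (X ^+ 2 + C ^+ 2) <= e * delta by rewrite -ler_pdivlMr // ge_min lexx orbT.
have d2 : 0 < delta ^+ 2 - k ^+ 2 by rewrite subr_gt0 ltr_sqr ?nnegrE ?(ltW k0) ?(ltW delta_gt0).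
have dk : 0 < delta + k by rewrite addr_gt0.
have := hX k k0 kd.
rewrite -ler_sqr ?nnegrE ?divr_ge0 ?sqrtr_ge0 ?(ltW X0) ?(ltW dk) //.
rewrite !exprMn !exprVn sqr_sqrtr ?(ltW d2) //.
rewrite ler_pdivrMr ?exprn_gt0 // [leRHS]mulrAC ler_pdivlMr //.
have -> : X ^+ 2 * (delta ^+ 2 - k ^+ 2) = X ^+ 2 * (delta - k) * (delta + k) by ring.
rewrite [(delta + k) ^+ 2]expr2 mulrA ler_pM2r // => h.
rewrite -(ler_pM2r delta_gt0); move: h ke; lra.
Qed.

(** * Poisson estimate and exponential decay for a real orbit function *)

Section SpectralGapDecay.
Variables (R : realType) (H : lmodType R[i]) (ip : H -> H -> R[i]).
Hypothesis hH : is_hilbert ip.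
Local Notation hnorm := (hnorm ip).
Local Notation B := (rip ip).
Local Notation mu := (@lebesgue_measure R).
Variable V : R -> H -> H.
Hypothesis hV : unitary_group ip V.
Variable m : R.
Hypotheses (m_gt0 : 0 < m) (hQ : generator_ge ip V m).
Variable delta : R.
Hypothesis delta_gt0 : 0 < delta.

Variables a b : H.
Hypothesis real_orbit : forall x, `|x| <= delta -> complex.Im (ip (V x a) b) = 0.

Local Notation C := (hnorm a * hnorm b).

Lemma kernel_estimate (kappa m' : R) : 0 < kappa -> kappa < delta -> 0 <= m' -> m' < m ->
  B a b * (expR (m' * delta) / (delta + kappa)) <= C / Num.sqrt (delta ^+ 2 - kappa ^+ 2).
Proof.
move=> k0 kd m'0 m'm.
have C0 : 0 <= C by rewrite mulr_ge0 ?(hnorm_ge0 ip).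
pose sq x := Num.sqrt (delta ^+ 2 - x ^+ 2).
pose phi x := B (V x a) b * (expR (m' * sq x) / (sq x + kappa)).
set d := Num.sqrt (delta ^+ 2 - kappa ^+ 2).
have d2 : 0 < delta ^+ 2 - kappa ^+ 2 by rewrite subr_gt0 ltr_sqr ?nnegrE ?(ltW k0) ?(ltW delta_gt0).
have dp : 0 < d by rewrite sqrtr_gt0.
have dE : d ^+ 2 = delta ^+ 2 - kappa ^+ 2 by rewrite sqr_sqrtr // ltW.
have dd : d < delta.
  by rewrite -ltr_sqr ?nnegrE ?(ltW dp) ?(ltW delta_gt0) // dE ltrBlDr ltrDl exprn_gt0.
have sq0 x : 0 <= sq x by exact: sqrtr_ge0.
have sqk x : 0 < sq x + kappa by rewrite ltr_wpDl.
have V0 : V 0 a = a by case: hV.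
have phi0 : phi 0 = B a b * (expR (m' * delta) / (delta + kappa)).
  by rewrite /phi V0 /sq expr0n subr0 sqrtr_sqr ger0_norm // ltW.
have cphi : continuous phi.
  have csq : continuous sq.
    move=> x; apply: continuous_cvg; first exact: sqrt_continuous.
    by apply: cvgB; [exact: cvg_cst|exact: exprn_continuous].
  move=> x; apply: cvgM; first exact: orbit_continuous.
  apply: cvgM.
    apply: continuous_cvg; first exact: continuous_expR.
    by apply: cvgM; [exact: cvg_cst|exact: csq].
  by apply: cvgV; [rewrite gt_eqF|apply: cvgD; [exact: csq|exact: cvg_cst]].
rewrite -phi0.
apply/ler_addgt0Pr => eps eps0.
have [neg|pos] := leP (phi 0 - eps) 0.
  have : 0 <= C / d by rewrite divr_ge0 // ltW.
  by lra.
have [r r0 rP] : exists2 r : R, 0 < r & forall x, `|x| < r -> phi 0 - eps <= phi x.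
  have /(@cvgrPdist_lt _ R) /(_ eps eps0) [r /= r0 rP] := cphi 0.
  exists r => // x hx; have := rP x; rewrite /= sub0r normrN => /(_ hx).
  by rewrite ltr_norml => /andP[_ h]; lra.
pose Phi := C * (expR (m' * delta) / kappa).
have phi_le x : `|phi x| <= Phi.
  rewrite normrM; apply: ler_pM => //.
    by apply: le_trans (rip_CS hH _ _) _; rewrite (unitary_hnorm hV).
  rewrite normrM gtr0_norm ?expR_gt0 // gtr0_norm ?invr_gt0 //.
  apply: ler_pM; rewrite ?expR_ge0 ?invr_ge0 ?(ltW (sqk x)) //.
    rewrite ler_expR ler_wpM2l // /sq -[leRHS](ger0_norm (ltW delta_gt0)) -[leRHS]sqrtr_sqr.
    by rewrite ler_wsqrtr // lerBlDr lerDl sqr_ge0.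
  by rewrite lef_pV2 ?posrE // lerDr.
(* For [|x| >= r] the function [phi] may fall to [- Phi], but there the Poisson kernel is at most
   [eta / r^2]; [W * eta] covers the deficit and vanishes with [eta]. *)
pose W := (phi 0 - eps + Phi) / r ^+ 2.
have W0 : 0 <= W.
  by rewrite divr_ge0 ?sqr_ge0 // addr_ge0 ?(ltW pos) // (le_trans _ (phi_le 0)).
(* Folding [\int K f = 0] at 0 leaves the Poisson kernel on [0, delta] and a
   tail dominated by the harmonic measure of the cut. *)
have main eta : 0 < eta ->
    2 * (phi 0 - eps) * atan (delta / eta) - 2 * W * eta * delta <= C * (pi / d).
  move=> e0.
  (* Starting from ['i *: a] makes the real pairing equal to - Im (K f), and - Im 1/(x + i eta) is
     the positive Poisson kernel. *)
  pose g x := B (slit_kernel delta kappa eta m' (x +i* 0) *: V x ('i *: a)) b.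
  have gE x : g x = - complex.Im (slit_kernel delta kappa eta m' (x +i* 0) * ip (V x a) b).
    by rewrite /g (unitaryZ hV) scalerA mulrC -scalerA (rip_iZl hH) (ipZl hH).
  have Kdom := slit_kernel_dominated delta_gt0 k0 e0 m'0 (lexx 0).
  have [mg [M gM]] : cauchy_dominated g by exact: orbit_integrand_dominated Kdom.
  have ig : mu.-integrable setT (EFin \o g).
    by apply: cauchy_dominated_integrable; split => //; exists M.
  have ign : mu.-integrable setT (EFin \o (fun x => g (- x))).
    apply: cauchy_dominated_integrable; split; first exact: measurableT_comp.
    by exists M => x; apply: le_trans (gM _) _; rewrite /oneDsqr sqrrN.
  have int0 : \int[mu]_(x in `[0, +oo[) (g x + g (- x)) = 0.
    by rewrite -Rintegral_fold //; exact: (boundary_integral hH hV m_gt0 hQ delta_gt0).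
  have ne2 x : 0 < x ^+ 2 + eta ^+ 2 by rewrite ltr_wpDl ?sqr_ge0 // exprn_gt0.
  have inside x : `|x| <= delta -> g x = phi x * (eta / (x ^+ 2 + eta ^+ 2)).
    move=> hx; rewrite gE /slit_kernel slit_sqrt_inside // -/(sq x).
    have -> : ip (V x a) b = (B (V x a) b)%:C.
      by have := real_orbit hx; rewrite /rip; case: (ip _ _) => u w /= ->.
    rewrite -rmorphM.
    have -> : cexp ((m' * sq x)%:C) = (expR (m' * sq x))%:C.
      by rewrite /cexp /= cos0 sin0 mulr1 mulr0.
    rewrite -[(sq x)%:C + _]rmorphD -fmorphV -rmorphM mulrAC -rmorphM.
    rewrite ImM (Re_real _) (Im_real _) mul0r addr0 ImV cabs_sqr /= addr0 add0r.
    by rewrite /phi; field; rewrite gt_eqF // gt_eqF.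
  (* Here s is purely imaginary: the exponential has modulus 1, and |s + kappa|^2 = x^2 - delta^2 +
     kappa^2 = x^2 - d^2. *)
  have outside x : delta < `|x| -> `|g x| <= C * (`|x|^-1 * (Num.sqrt (x ^+ 2 - d ^+ 2))^-1).
    move=> hx; have x0 : 0 < `|x| by exact: lt_trans hx.
    have xx : 0 < x ^+ 2 - d ^+ 2.
      rewrite subr_gt0 -[x ^+ 2]real_normK ?num_real // ltr_sqr ?nnegrE ?(ltW dp) //.
      exact: lt_trans hx.
    have := slit_sqrt_outside delta_gt0 (ltW hx).
    have := slit_sqrt_eqs delta (z := x +i* 0) (lexx 0); move=> [+ _].
    have Hk : cabs (slit_kernel delta kappa eta m' (x +i* 0)) =
       expR (m' * complex.Re (slit_sqrt delta (x +i* 0))) *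
       (cabs (slit_sqrt delta (x +i* 0) + kappa%:C))^-1 * (cabs ((x +i* 0) + (0 +i* eta)))^-1.
      by rewrite !cabsM !cabsV cabs_cexp ReM (Re_real m') (Im_real m') mul0r subr0.
    move: Hk; set s := slit_sqrt delta (x +i* 0) => Hk q2 p0.
    have nk : cabs (slit_kernel delta kappa eta m' (x +i* 0)) <=
        `|x|^-1 * (Num.sqrt (x ^+ 2 - d ^+ 2))^-1.
      rewrite Hk p0 mulr0 expR0 mul1r mulrC.
      have q2' : complex.Im s ^+ 2 = x ^+ 2 - delta ^+ 2.
        by move: q2; rewrite p0 /= !expr0n; lra.
      apply: ler_pM; rewrite ?invr_ge0 ?cabs_ge0 //.
        have hz : `|x| <= cabs ((x +i* 0) + (0 +i* eta)).
          by apply: le_trans (ler_Re_cabs _); rewrite /= addr0.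
        by rewrite lef_pV2 ?posrE // (lt_le_trans x0).
      have hs : Num.sqrt (x ^+ 2 - d ^+ 2) <= cabs (s + kappa%:C).
        rewrite /cabs ler_wsqrtr // ReD ImD p0 (Re_real kappa) (Im_real kappa) add0r addr0 q2' dE.
        by rewrite le_eqVlt; apply/orP; left; apply/eqP; ring.
      have hsp : 0 < Num.sqrt (x ^+ 2 - d ^+ 2) by rewrite sqrtr_gt0.
      by rewrite lef_pV2 ?posrE // (lt_le_trans hsp).
    apply: le_trans (rip_CS hH _ _) _.
    rewrite (hnormZ hH) (unitary_hnorm hV) (hnormZ hH).
    have -> : cabs 'i = 1 :> R by rewrite /cabs /= expr0n expr1n add0r sqrtr1.
    by rewrite mul1r -mulrA mulrC ler_wpM2l.
  have lower x : `|x| <= delta -> (phi 0 - eps) * (eta / (x ^+ 2 + eta ^+ 2)) - W * eta <= g x.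
    move=> hx; rewrite inside //.
    have p0 : 0 < eta / (x ^+ 2 + eta ^+ 2) by rewrite divr_gt0.
    have [xr|xr] := ltP `|x| r.
      have := ler_wpM2r (ltW p0) (rP x xr).
      by have : 0 <= W * eta by [rewrite mulr_ge0 // ltW]; lra.
    have pr : eta / (x ^+ 2 + eta ^+ 2) <= eta / r ^+ 2.
      rewrite ler_wpM2l ?(ltW e0) // lef_pV2 ?posrE ?exprn_gt0 //.
      apply: (@le_trans _ _ (x ^+ 2)); last by rewrite lerDl sqr_ge0.
      by rewrite -[x ^+ 2]real_normK ?num_real // ler_sqr ?nnegrE ?(ltW r0).
    have := phi_le x; rewrite ler_norml => /andP[+ _] => h1.
    have := ler_wpM2r (ltW p0) h1.
    have PP : 0 <= phi 0 - eps + Phi.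
      by rewrite addr_ge0 ?(ltW pos) // (le_trans _ (phi_le 0)).
    have := ler_wpM2l PP pr.
    have -> : (phi 0 - eps + Phi) * (eta / r ^+ 2) = W * eta by rewrite /W; ring.
    lra.
  have igS (A : set R) : measurable A -> mu.-integrable A (EFin \o (fun x => g x + g (- x))).
    move=> mA; apply: (integrableS measurableT) => //.
    exact: (integrableD measurableT ig ign).
  have split0 : \int[mu]_(x in `[0, +oo[) (g x + g (- x)) =
      \int[mu]_(x in `[0, delta]) (g x + g (- x)) + \int[mu]_(x in `]delta, +oo[) (g x + g (- x)).
    rewrite -Rintegral_setU //.
    - by rewrite -itv_bndbnd_setU // bnd_simp ltW.
    - by apply: igS; apply: measurableU.
    - apply/disj_setPS => x [] /=; rewrite !in_itv /= => /andP[_ h1].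
      by rewrite andbT ltNge h1.
  have [ip1 ip2] := Rintegral_poisson delta_gt0 e0.
  have in_lower : 2 * (phi 0 - eps) * atan (delta / eta) - 2 * W * eta * delta
      <= \int[mu]_(x in `[0, delta]) (g x + g (- x)).
    have i1 : mu.-integrable `[0, delta] (EFin \o (fun x : R => 2 * (phi 0 - eps) * (eta / (x ^+ 2 + eta ^+ 2)))).
      exact: (integrableZl _ (2 * (phi 0 - eps)) ip1).
    have i2 : mu.-integrable `[0, delta] (EFin \o (fun=> 2 * W * eta)).
      apply: continuous_compact_integrable; first exact: segment_compact.
      by apply: continuous_subspaceT => x; exact: cvg_cst.
    have -> : 2 * (phi 0 - eps) * atan (delta / eta) - 2 * W * eta * delta =
      \int[mu]_(x in `[0, delta]) (2 * (phi 0 - eps) * (eta / (x ^+ 2 + eta ^+ 2)) - 2 * W * eta).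
      rewrite RintegralB // RintegralZl // ip2 Rintegral_cst //.
      congr (_ - _ * _); apply/esym; transitivity (fine (delta%:E : \bar R)) => //.
      by congr fine; apply: etrans (lebesgue_measure_itv _) _; rewrite /= lte_fin delta_gt0 sube0.
    apply: le_Rintegral => //; first exact: (integrableB _ i1 i2).
      exact: igS.
    move=> x /=; rewrite in_itv /= => /andP[x1 x2].
    have hx : `|x| <= delta by rewrite ger0_norm.
    have l1 := lower x hx; have := lower (- x); rewrite normrN sqrrN => /(_ hx) l2.
    by apply: le_trans (lerD l1 l2); rewrite le_eqVlt; apply/orP; left; apply/eqP; ring.
  have out_lower : - (C * (pi / d)) <= \int[mu]_(x in `]delta, +oo[) (g x + g (- x)).
    have iI := igS _ (measurable_itv `]delta, +oo[).
    have := @le_normr_Rintegral _ _ _ mu _ _ (measurable_itv _) iI.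
    rewrite ler_norml => /andP[+ _]; apply: le_trans; rewrite lerN2 /Rintegral.
    have h0 := integral_slit dp dd.
    rewrite -lee_fin fineK; last first.
      apply: integrable_fin_num => //.
      exact: (integrable_abse iI).
    have -> : C * (pi / d) = 2 * C * (pi / (2 * d)) by field; rewrite gt_eqF.
    have C20 : 0 <= 2 * C by rewrite mulr_ge0.
    have mT : measurable_fun `]delta, +oo[ (fun x : R => x^-1 * (Num.sqrt (x ^+ 2 - d ^+ 2))^-1).
      apply: open_continuous_measurable_fun => // x; rewrite inE /= in_itv /= andbT => hx.
      have x0 : 0 < x by exact: lt_trans hx.
      have xx : 0 < x ^+ 2 - d ^+ 2.
        rewrite subr_gt0 ltr_sqr ?nnegrE ?(ltW dp) ?(ltW x0) //; exact: lt_trans hx.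
      apply: cvgM; first by apply: cvgV; [rewrite gt_eqF|exact: cvg_id].
      apply: cvgV; first by rewrite gt_eqF // sqrtr_gt0.
      apply: continuous_cvg; first exact: sqrt_continuous.
      by apply: cvgB; [exact: exprn_continuous|exact: cvg_cst].
    have T0 x : x \in `]delta, +oo[ -> 0 <= x^-1 * (Num.sqrt (x ^+ 2 - d ^+ 2))^-1.
      rewrite in_itv /= andbT => hx.
      by rewrite mulr_ge0 ?invr_ge0 // ltW // (lt_trans _ hx).
    apply: (@le_trans _ _ (\int[mu]_(x in `]delta, +oo[) ((2 * C)%:E * (x^-1 * (Num.sqrt (x ^+ 2 - d ^+ 2))^-1)%:E))%E).
      apply: ge0_le_integral => //.
      - by apply/measurable_EFinP; apply: measurableT_comp => //; apply: measurable_funTS;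
          apply: measurable_funD => //; exact: measurableT_comp.
      - by apply: measurable_funeM; exact/measurable_EFinP.
      - move=> x /= hx; rewrite -EFinM lee_fin.
        have dx : delta < x by move: hx; rewrite in_itv /= andbT.
        have x0 : 0 < x by exact: lt_trans dx.
        have nx : delta < `|x| by rewrite gtr0_norm.
        have o1 := outside x nx; have := outside (- x).
        rewrite normrN sqrrN => /(_ nx) o2; move: o1 o2; rewrite (gtr0_norm x0) => o1 o2.
        apply: le_trans (ler_normD _ _) _; apply: le_trans (lerD o1 o2) _.
        by rewrite le_eqVlt; apply/orP; left; apply/eqP; ring.
    rewrite ge0_integralZl //; last exact/measurable_EFinP.
    rewrite [leRHS]EFinM lee_wpmul2l ?lee_fin //.
    by rewrite integral_itv_obnd_cbnd //; exact/measurable_EFinP.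
  move: int0; rewrite split0 => /eqP; rewrite addr_eq0 => /eqP e.
  by apply: le_trans in_lower _; rewrite e lerNl.
have lim : (phi 0 - eps) * pi <= C * (pi / d).
  apply/ler_addgt0Pr => e e0.
  pose e1 := e / (4 * (phi 0 - eps)).
  have e10 : 0 < e1 by rewrite divr_gt0 // mulr_gt0.
  have /(@cvgrPdist_lt _ R) /(_ e1 e10) [u0 [_ u0P]] := @cvgy_atan R.
  pose c := 2 * W * delta * delta.
  have c0 : 0 <= c by do 2 (apply: mulr_ge0; last exact: ltW); apply: mulr_ge0.
  (* Taking [eta = delta / u] turns [atan (delta / eta)] into [atan u]. Its distance [e1] from pi/2
     and the error [c / u] each cost [e / 2]. *)
  pose u := Num.max u0 (2 * c / e) + 1.
  have u1 : u0 < u by rewrite /u ltr_pwDr // le_max lexx.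
  have u2 : 2 * c / e <= u by rewrite /u ler_wpDr // le_max lexx orbT.
  have q0 : 0 <= 2 * c / e by apply: divr_ge0; [exact: mulr_ge0|exact: ltW].
  have up : 0 < u by rewrite /u ltr_wpDl // le_max q0 orbT.
  have := u0P u u1; rewrite /= ltr_norml => /andP[_ h1].
  have := main (delta / u) (divr_gt0 delta_gt0 up).
  have -> : delta / (delta / u) = u by field; rewrite !gt_eqF.
  have h2 : 2 * W * (delta / u) * delta <= e / 2.
    have -> : 2 * W * (delta / u) * delta = c / u by rewrite /c; ring.
    by rewrite ler_pdivrMr //; move: u2; rewrite ler_pdivrMr //; lra.
  have h3 : 2 * (phi 0 - eps) * (pi / 2 - e1) <= 2 * (phi 0 - eps) * atan u.
    by rewrite ler_pM2l ?mulr_gt0 //; lra.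
  have h4 : 2 * (phi 0 - eps) * e1 = e / 2 by rewrite /e1; field; rewrite gt_eqF.
  move: h3; rewrite mulrBr h4; lra.
rewrite -lerBlDr -(ler_pM2r (pi_gt0 R)) (le_trans lim) // mulrA mulrAC lexx //.
Qed.

Lemma real_orbit_decay : B a b <= expR (- (m * delta)) * C.
Proof.
have C0 : 0 <= C by rewrite mulr_ge0 ?(hnorm_ge0 ip).
have [neg|pos] := leP (B a b) 0.
  by apply: le_trans neg _; rewrite mulr_ge0 // expR_ge0.
have step m' : 0 <= m' -> m' < m -> B a b * expR (m' * delta) <= C.
  move=> m'0 m'm; apply: (ratio_limit delta_gt0 C0); first by rewrite mulr_gt0 // expR_gt0.
  by move=> k k0 kd; rewrite -mulrA; exact: kernel_estimate.
rewrite expRN [leRHS]mulrC ler_pdivlMr ?expR_gt0 //.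
set X := B a b * expR (m * delta).
apply/ler_addgt0Pr => e e0.
have X0 : 0 < X by rewrite mulr_gt0 // expR_gt0.
(* For [m' = m - t] the loss factor [e^{- t delta} >= 1 - t delta] costs at most [t X delta <= e];
   the minimum with [m] keeps [m'] nonnegative. *)
pose t := Num.min m (e / (X * delta)).
have xd : 0 < X * delta by rewrite mulr_gt0.
have t0 : 0 < t by rewrite lt_min m_gt0 divr_gt0.
have tm : t <= m by rewrite ge_min lexx.
have te : t * (X * delta) <= e by rewrite -ler_pdivlMr // ge_min lexx orbT.
have := step (m - t).
rewrite subr_ge0 tm => /(_ isT); rewrite ltrBlDr ltrDl t0 => /(_ isT).
rewrite mulrBl expRD mulrA -/X => h.
have : X * (1 - t * delta) <= X * expR (- (t * delta)) by rewrite ler_pM2l // expR_ge1Dx.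
move: h te; lra.
Qed.

End SpectralGapDecay.

(** * From the inclusion of ranges to the angle bound *)

Unset Implicit Arguments.

Theorem theorem5p6 (R : realType) (H : lmodType R[i]) (ip : H -> H -> R[i])
  (hH : is_hilbert ip)
  (E F : H -> H) (hE : real_orth_proj ip E) (hF : real_orth_proj ip F)
  (V : R -> H -> H) (hV : unitary_group ip V)
  (m : R) (hm : 0 < m) (hQ : generator_ge ip V m)
  (delta : R) (hdelta : 0 < delta)
  (hEF : forall t : R, - delta <= t <= delta ->
     proj_le E (fun x => V t (symp_compl F (V (- t) x)))) :
  [/\ op_norm_le ip (fun x => E (F x)) (expR (- (m * delta))),
      (forall K : H -> H, is_meet ip E F K -> forall x : H, K x = 0) &
      (forall J : H -> H, is_join ip E F J ->
         op_norm_le ip (fun x => E x + F x - J x) (expR (- (m * delta))))].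
Proof.
have c0 : 0 < expR (- (m * delta)) by exact: expR_gt0.
have c1 : expR (- (m * delta)) < 1 by rewrite -expR0 ltr_expR oppr_lt0 mulr_gt0.
(* The inclusion at [- t] writes [V t (E x)] as F' v. Since i F' v = (1 - F)(i v) is orthogonal to
   the range of F for the real inner product, the imaginary part vanishes. *)
have real_orbit x y t : `|t| <= delta -> complex.Im (ip (V t (E x)) (F y)) = 0.
  rewrite -normrN ler_norml => ht.
  have [u <-] := hEF (- t) ht (E x) (ex_intro _ x erefl).
  rewrite -(unitaryDt hV) subrr opprK; case: (hV) => _ _ V0 _ _; rewrite V0.
  move: (V t u) => v; apply/eqP; rewrite -oppr_eq0 -(rip_iZl hH) /symp_compl; apply/eqP.
  rewrite scalerDr scalerA -expr2 sqr_i scaleN1r (ripBl hH).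
  by rewrite (proj_adj hF) (projK hF) -(proj_adj hF) (proj_adj hF) subrr.
have angle x y : rip ip (E x) (F y) <= expR (- (m * delta)) * (hnorm ip (E x) * hnorm ip (F y)).
  by apply: (real_orbit_decay hH hV hm hQ hdelta) => t; exact: real_orbit.
split.
- move=> x; apply: le_trans (proj_comp_norm hH hE hF c0 angle x) _.
  by rewrite ler_pM2l // proj_le_norm.
- by move=> K hK x; apply: (meet_trivial hH hE hF c1 angle hK).
- by move=> J hJ; apply: (join_norm hH hE hF c0 c1 angle hJ).
Qed.
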